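(* Let $P_1$ and $P_2$ be non-constant complex rational functions of degrees $n_1$ and $n_2$, respectively. Then the following three conditions are equivalent: (i) $\mathcal{L}_{P_1}$ and $\mathcal{L}_{P_2}$ have more than $2n_1n_2$ common points. (ii) $\mathcal{L}_{P_1}\cap\mathcal{L}_{P_2}$ is infinite. (iii) There exist rational functions $W$, $B_1$, $B_2$ such that $P_1=B_1\circ W$ and $P_2=B_2\circ W$, and each of $B_1,B_2$ maps the unit circle $\mathbb{T}$ to itself (i.e. $B_k(\mathbb{T})\subset\mathbb{T}$ for $k=1,2$). Furthermore, for any natural numbers $n_1,n_2\ge 1$ there exist complex rational functions $P_1$, $P_2$ of degrees $n_1$ and $n_2$, respectively, such that $\mathcal{L}_{P_1}$ and $\mathcal{L}_{P_2}$ have exactly $2n_1n_2$ intersection points.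
   Context: For a non-constant complex rational function $P$ (viewed as a map of the Riemann sphere $\widehat{\mathbb{C}}=\mathbb{C}\cup\{\infty\}$ to itself), the lemniscate of $P$ is $\mathcal{L}_P=\{z\in\mathbb{C}: |P(z)|=1\}$. The degree of a rational function is its degree as a self-map of the Riemann sphere (the maximum of the degrees of numerator and denominator in lowest terms). $\mathbb{T}=\{z\in\mathbb{C}:|z|=1\}$. *)

(* Defs.v *)
From mathcomp Require Import all_boot all_order all_algebra.
From mathcomp Require Import complex.
From mathcomp Require Import classical_sets functions cardinality reals.

Set Implicit Arguments.
Unset Strict Implicit.
Unset Printing Implicit Defensive.

Import Order.TTheory GRing.Theory Num.Theory.

Local Open Scope classical_set_scope.
Local Open Scope ring_scope.

(* The Riemann sphere: [Some z] is the finite point z, [None] is infinity. *)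
Definition sphere (R : realType) : Type := option R[i].

(* A rational function in lowest terms (the constant infinity is excluded). *)
Record ratfun (R : realType) := RatFun {
  num : {poly R[i]};
  den : {poly R[i]};
  den_neq0 : den != 0;
  coprime_num_den : coprimep num den }.

(* When size num <= size den, the limit at infinity is the quotient of the
   coefficients of index deg den; it is 0 if deg num < deg den. *)
Definition ratmap (R : realType) (P : ratfun R) (z : sphere R) : sphere R :=
  match z with
  | Some x =>
      if (den P).[x] == 0 then None else Some ((num P).[x] / (den P).[x])
  | None =>
      if (size (den P) < size (num P))%N then None
      else Some ((num P)`_(size (den P)).-1 / lead_coef (den P))
  end.

Coercion ratmap : ratfun >-> Funclass.

Definition ratdeg (R : realType) (P : ratfun R) : nat :=
  maxn (size (num P)).-1 (size (den P)).-1.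

Definition nonconstant (R : realType) (P : ratfun R) : Prop :=
  ~ exists c : sphere R, forall z : sphere R, P z = c.

Definition unit_circle (R : realType) : set R[i] := [set z | `|z| = 1].

Arguments unit_circle : clear implicits.

(* Poles of P are not on its lemniscate. *)
Definition lemniscate (R : realType) (P : ratfun R) : set R[i] :=
  [set z | exists2 w : R[i], P (Some z) = Some w & `|w| = 1].

Definition preserves_circle (R : realType) (B : ratfun R) : Prop :=
  B @` (Some @` unit_circle R) `<=` Some @` unit_circle R.

(* Main.v *)
(* For P = p / q put F(z, w) = p(z) conj(p)(w) - q(z) conj(q)(w), so that the
   lemniscate of P is given by F(z, conj(z)) = 0.  The resultant in w of the
   cofactors of G = gcd(F1, F2) has degree at most 2 n1 n2 in z, so with more
   common points than that G vanishes at some (z, conj(z)).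

   On the curve G = 0 one has P_i(z) = 1 / conj(P_i)(w), hence every element of
   C(P1, P2) agrees there with a rational function of w.  The coefficients of G,
   made monic in w, lie in C(P1, P2).  As in the proof of Luroth's theorem, a
   nonconstant one f / g, equal to d / e on the curve, gives
   G = f(z) e(w) - g(z) d(w) by comparing degrees in z, and then both P_i are
   rational functions of f / g.  Since G is Hermitian up to a constant factor, it is
   a Hermitian form of rank 2 in (f, g); it has an isotropic vector because G
   vanishes at some (z, conj(z)), so after a linear change of (f, g) it becomes
   f conj(f) - g conj(g).  With W = f / g and P_i = B_i o W, the equality |W(z)| = 1
   forces F_i(z, conj(z)) = 0, that is |P_i(z)| = 1, and W is onto the sphere.

   The extremal example intersects n1 lines through 0 with n2 circles through 1
   and -1. *)

Require Import Defs.
From HB Require Import structures.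
From mathcomp Require Import all_boot all_order all_algebra.
From mathcomp Require Import complex.
From mathcomp Require Import classical_sets functions cardinality reals.
From mathcomp Require Import separable zify ring.
From mathcomp Require boolp finmap.

Set Implicit Arguments.
Unset Strict Implicit.
Unset Printing Implicit Defensive.

Import Order.TTheory GRing.Theory Num.Theory.

Local Open Scope classical_set_scope.
Local Open Scope ring_scope.

(** * Polynomial division and gcd with coefficients in a subfield *)

Section SubfieldCoefficients.

Variable K : fieldType.

Record is_subfield (S : K -> Prop) : Prop := IsSubfield {
  subfield1 : S 1;
  subfieldB : forall x y, S x -> S y -> S (x - y);
  subfieldM : forall x y, S x -> S y -> S (x * y);
  subfieldV : forall x, S x -> S x^-1 }.

Definition coefs_in (S : K -> Prop) (p : {poly K}) := forall i, S p`_i.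

Variable S : K -> Prop.
Hypothesis Sfield : is_subfield S.

Lemma coefs_in_modp p d : coefs_in S p -> coefs_in S d -> coefs_in S (p %% d).
Proof.
move=> Sp Sd; have [->|nzd] := eqVneq d 0; first by rewrite modp0.
elim/poly_ind: p Sp => [|p c IHp] Sp; first by rewrite mod0p.
have Sp0 : coefs_in S p.
  by move=> i; have := Sp i.+1; rewrite coefD coefMX coefC addr0.
have Sc : S c by have := Sp 0%N; rewrite coefD coefMX coefC add0r.
set r := p %% d in IHp; have Sr := IHp Sp0.
set s := r * 'X + c%:P; set n := (size d).-1.
have sz_d : size d = n.+1 by rewrite prednK ?size_poly_gt0.
have sz_r : (size r <= n)%N by rewrite -ltnS -sz_d ltn_modp.
have Ss : coefs_in S s.
  move=> i; rewrite coefD coefMX coefC.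
  case: i => [|i] /=; first by rewrite add0r.
  by rewrite addr0; apply: Sr.
(* One step of long division: [s] has degree at most [n], the degree of [d], so a single multiple of
   [d], which cancels the coefficient of index [n], reduces it. *)
suff -> : (p * 'X + c%:P) %% d = s - (s`_n / lead_coef d) *: d.
  move=> i; rewrite coefB coefZ; apply: subfieldB => //.
  apply: subfieldM => //; apply: subfieldM => //; apply: subfieldV => //.
  by rewrite lead_coefE.
symmetry; apply: (modpP (q := p %/ d * 'X + (s`_n / lead_coef d)%:P)).
  rewrite mulrDl -mul_polyC /s mulrAC {1}(divp_eq p d) -/r.
  by ring.
rewrite sz_d ltnS; apply/leq_sizeP => j; rewrite leq_eqVlt => /orP[/eqP <-|lt_nj].
  rewrite coefB coefZ [d`_n]/(lead_coef d) -lead_coefE divfK ?subrr //.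
  by rewrite lead_coef_eq0.
rewrite coefB coefZ coefD coefMX coefC.
case: j lt_nj => // j lt_nj /=; rewrite addr0.
have -> : r`_j = 0 by rewrite nth_default // (leq_trans sz_r).
have -> : d`_j.+1 = 0 by rewrite nth_default // sz_d.
by rewrite mulr0 subrr.
Qed.

(** The Euclidean algorithm uses only field operations on coefficients. A gcd is determined up to a
    scalar that may lie outside the subfield, hence the statement up to [%=]. *)
Lemma coefs_in_gcdp p q :
  coefs_in S p -> coefs_in S q -> exists2 g, coefs_in S g & g %= gcdp p q.
Proof.
have [n] := ubnP (size q); elim: n => // n IHn in p q * => le_q Sp Sq.
have [->|nzq] := eqVneq q 0; first by exists p; rewrite // gcdp0 eqpxx.
have Sr := coefs_in_modp Sp Sq.
have [|g Sg eq_g] := IHn q (p %% q) _ Sq Sr.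
  exact: leq_trans (ltn_modpN0 p nzq) le_q.
exists g => //; apply: (eqp_trans eq_g).
by apply: eqp_trans (gcdp_modr _ _) _; apply: gcdpC.
Qed.

End SubfieldCoefficients.

(** * Degree bounds for determinants and resultants *)

Lemma size_det_leq (R : comNzRingType) n (M : 'M[{poly R}]_n) (b : 'I_n -> nat) :
  (forall i j, size (M i j) <= (b i).+1)%N -> (size (\det M) <= (\sum_i b i).+1)%N.
Proof.
move=> szM; apply: leq_trans (size_sum _ _ _) _; apply/bigmax_leqP => s _.
rewrite size_Msign; apply: leq_trans (size_prod_leq _ _) _.
rewrite leq_subLR addnS ltnS cardT size_enum_ord.
apply: leq_trans (_ : \sum_i (1 + b i) <= _)%N; first exact: leq_sum.
by rewrite big_split /= sum1_card card_ord.
Qed.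

(** The Sylvester matrix has [(size B).-1] rows made of coefficients of [A], of degree at most [m]
    in the inner variable, and [(size A).-1] rows made of those of [B], of degree at most [n]. *)
Lemma size_resultant (R : comNzRingType) (A B : {poly {poly R}}) m n :
    (sizeY A <= m.+1)%N -> (sizeY B <= n.+1)%N ->
  (size (resultant A B) <= ((size B).-1 * m + (size A).-1 * n).+1)%N.
Proof.
move=> szA szB.
pose b (i : 'I_((size B).-1 + (size A).-1)) :=
  if fintype.split i is inl _ then m else n.
have -> : ((size B).-1 * m + (size A).-1 * n = \sum_i b i)%N.
  rewrite big_split_ord /= -[in LHS](card_ord (size B).-1).
  rewrite -[X in (_ + X * _)%N](card_ord (size A).-1).
  rewrite -!sum_nat_const; congr (_ + _)%N; apply: eq_bigr => i _.
    by rewrite /b (unsplitK (inl i)).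
  by rewrite /b (unsplitK (inr i)).
apply: size_det_leq => i j; rewrite Sylvester_mxE /b.
case: (fintype.split i) => k /=; case: (k <= j)%N;
  rewrite ?mulr0n ?mulr1n ?size_poly0 //.
  exact: leq_trans (max_size_coefXY _ _) szA.
exact: leq_trans (max_size_coefXY _ _) szB.
Qed.

Lemma fraction_ratio (R : idomainType) (x : {fraction R}) :
  exists n d, d != 0 /\ x = FracField.tofrac n / FracField.tofrac d.
Proof.
elim/quotW: x => x; exists (\n_x), (\d_x); split; first exact: denom_ratioP.
apply: (canRL (mulfK _)); first by rewrite tofrac_eq0 denom_ratioP.
unlock FracField.tofrac; rewrite -[LHS]FracField.pi_mul.
rewrite /FracField.mulf !numden_Ratio ?oner_neq0 // mulr1.
apply/eqmodP; rewrite /= FracField.equivfE.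
by rewrite !numden_Ratio ?mulf_neq0 ?oner_neq0 ?denom_ratioP // mulr1 mulrC.
Qed.

(** * Polynomials in z and w, fractions in z, and the Gauss lemma *)

Section BivariatePolynomials.

Variable C : closedFieldType.
Implicit Types (A B G H : {poly {poly C}}) (f g d e p q r : {poly C}).

(* K is a field of fractions of C[z], kept abstract because conversion inside
   the quotient type {fraction {poly C}} is costly. *)
Variables (K : fieldType) (iota : {rmorphism {poly C} -> K}).
Hypothesis iota_inj : injective iota.
Hypothesis iota_ratio : forall x, exists n d, d != 0 /\ x = iota n / iota d.
Local Notation "x %:F" := (iota x).

Lemma iota_eq0 f : (f%:F == 0) = (f == 0).
Proof. by rewrite -(inj_eq iota_inj) rmorph0. Qed.

(* Polynomials in the outer variable w over C[z]; [frac_coefs] embeds C[z][w]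
   into C(z)[w]. *)
Definition frac_coefs A : {poly K} := map_poly iota A.

Definition const_coefs p : {poly K} := frac_coefs p^:P.

(** Says that no w - c divides [A]. Applied to [swapXY A] it says that no z - c does, that is, [A]
    is primitive over C[z]. *)
Definition no_constant_root A := forall c : C, A.[c%:P] != 0.

(* The polynomial f(z) e(w) - g(z) d(w). *)
Definition tensor f g e d : {poly {poly C}} := f%:P * e^:P - g%:P * d^:P.

Lemma frac_coefs_inj : injective frac_coefs.
Proof. by apply: map_inj_poly => //; rewrite rmorph0. Qed.

Lemma frac_coefs_eq0 A : (frac_coefs A == 0) = (A == 0).
Proof. by rewrite -(inj_eq frac_coefs_inj) /frac_coefs rmorph0. Qed.

Lemma size_frac_coefs A : size (frac_coefs A) = size A.
Proof.
by apply: size_map_inj_poly => //; rewrite rmorph0.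
Qed.

Lemma frac_coefsM A B : frac_coefs (A * B) = frac_coefs A * frac_coefs B.
Proof. exact: rmorphM. Qed.

Lemma frac_coefsC f : frac_coefs f%:P = f%:F%:P.
Proof. exact: map_polyC. Qed.

Lemma frac_coefs_clear (P : {poly K}) :
  exists h A, h != 0 /\ frac_coefs A = h%:F *: P.
Proof.
elim/poly_ind: P => [|P c [h [A [nzh eqA]]]].
  by exists 1, 0; rewrite oner_neq0 scaler0 /frac_coefs rmorph0.
have [n [d [nzd ->]]] := iota_ratio c.
exists (h * d), (d%:P * A * 'X + (h * n)%:P); split; first by rewrite mulf_neq0.
rewrite /frac_coefs rmorphD !rmorphM /= map_polyX -/(frac_coefs A) eqA.
rewrite map_polyC /= map_polyC /= -!mul_polyC !polyCM.
have nzdF : d%:F != 0 :> K by rewrite iota_eq0.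
rewrite mulrDr; congr (_ + _); first by rewrite mulrCA !mulrA.
by rewrite map_polyC /= -!polyCM -mulrA [d%:F * _]mulrC divfK.
Qed.

Lemma no_constant_root_neq0 A : no_constant_root A -> A != 0.
Proof. by move=> /(_ 0); apply: contraNneq => ->; rewrite horner0. Qed.

Lemma no_constant_rootM A B :
  no_constant_root (A * B) -> no_constant_root A /\ no_constant_root B.
Proof.
move=> nrAB; split=> c; have := nrAB c;
  by rewrite hornerM mulf_eq0 negb_or; case/andP.
Qed.

Lemma constant_rootP A c : A.[c%:P] = 0 -> exists B, A = ('X - c%:P)^:P * B.
Proof.
move=> /eqP/factor_theorem[B ->]; exists B.
by rewrite mulrC rmorphB /= map_polyX map_polyC.
Qed.

(* A polynomial over C[z] is primitive as soon as no z - c divides it. *)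
Lemma Gauss_primitive G A H h :
    no_constant_root (swapXY G) -> h != 0 -> h%:P * A = G * H ->
  exists H', A = G * H'.
Proof.
move=> primG; have [n] := ubnP (size h); elim: n => // n IHn in h H *.
move=> szh nzh eqAH.
have [/closed_rootP[c root_h]|] := boolP (size h != 1%N); last first.
  rewrite negbK => /size_poly1P[c nzc eq_h]; exists ((c^-1)%:P%:P * H).
  by rewrite mulrCA -eqAH eq_h mulrA -!polyCM mulVf // !polyC1 mul1r.
have /factor_theorem[h1 eq_h] := root_h.
(* At z = c the product [G * H] vanishes while [G] does not, so z - c divides [H] and can be
   cancelled on both sides. *)
have [H1 eqH] : exists H1, H = ('X - c%:P)%:P * H1.
  have /constant_rootP[B eqB] : (swapXY H).[c%:P] = 0.
    have /eqP := congr1 (fun P => (swapXY P).[c%:P]) eqAH.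
    rewrite !rmorphM /= !hornerM swapXY_polyC horner_map /= (eqP root_h) polyC0.
    by rewrite mul0r eq_sym mulf_eq0 (negbTE (primG c)) => /eqP.
  by exists (swapXY B); rewrite -[H]swapXYK eqB rmorphM /= swapXY_map_polyC.
have nz_c : ('X - c%:P)%:P != 0 :> {poly {poly C}}.
  by rewrite polyC_eq0 polyXsubC_eq0.
have nz_h1 : h1 != 0 by apply: contraNneq nzh => h10; rewrite eq_h h10 mul0r.
apply: (IHn h1 H1) => //.
  by move: szh; rewrite eq_h size_Mmonic ?monicXsubC // size_XsubC addn2.
apply: (mulfI nz_c); rewrite [RHS]mulrCA -eqH -eqAH eq_h polyCM.
by rewrite mulrCA mulrA.
Qed.

Lemma Gauss_dvdp_frac G A :
    no_constant_root (swapXY G) -> frac_coefs G %| frac_coefs A ->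
  exists H, A = G * H.
Proof.
move=> primG /dvdpP[Q eqA].
have [h [H [nzh eqH]]] := frac_coefs_clear Q.
apply: (@Gauss_primitive G A H h) => //; apply: frac_coefs_inj.
by rewrite !frac_coefsM frac_coefsC mul_polyC eqA eqH scalerAl mulrC.
Qed.

(** Denominators are cleared, then factors z - c are divided out one by one; each division lowers
    the degree in z, measured by [sizeY]. *)
Lemma primitive_part (P : {poly K}) :
  P != 0 -> exists G, no_constant_root (swapXY G) /\ frac_coefs G %= P.
Proof.
move=> nzP; have [h [A [nzh eqA]]] := frac_coefs_clear P.
have {h nzh eqA} : frac_coefs A %= P.
  by rewrite eqA eqp_scale // iota_eq0.
have [n] := ubnP (sizeY A); elim: n => // n IHn in A *.
move=> szA eqA; have nzA : A != 0.
  apply: contraNneq nzP => A0.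
  by rewrite -eqp0 -(eqp_ltrans eqA) A0 eqp0 frac_coefs_eq0.
have [primA|/boolp.existsNP[c /negP]] := boolp.pselect (no_constant_root (swapXY A)).
  by exists A.
rewrite negbK => /eqP/constant_rootP[B eqB].
have {}eqB : A = ('X - c%:P)%:P * swapXY B.
  by rewrite -[A]swapXYK eqB rmorphM /= swapXY_map_polyC.
have nz_c : 'X - c%:P != 0 by rewrite polyXsubC_eq0.
apply: (IHn (swapXY B)).
  move: szA; rewrite sizeYE eqB rmorphM /= swapXY_polyC swapXYK sizeYE swapXYK.
  have nzB : B != 0.
    by apply: contraNneq nzA => B0; rewrite eqB B0 rmorph0 mulr0.
  rewrite size_mul // ?map_polyC_eq0 ?polyXsubC_eq0 //.
  by rewrite size_map_polyC size_XsubC.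
apply: eqp_trans eqA; rewrite eqB frac_coefsM frac_coefsC mul_polyC eqp_sym.
by rewrite eqp_scale // iota_eq0.
Qed.

(** * The forms f(z) e(w) - g(z) d(w) *)

Lemma tensor_horner f g e d c :
  (tensor f g e d).[c%:P] = e.[c] *: f - d.[c] *: g.
Proof.
rewrite /tensor hornerD hornerN !hornerM !hornerC !horner_map /=.
by rewrite ![_ * _%:P]mulrC !mul_polyC.
Qed.

Lemma tensor_horner2 f g e d c x :
  (tensor f g e d).[c%:P].[x] = f.[x] * e.[c] - g.[x] * d.[c].
Proof. by rewrite tensor_horner hornerD hornerN !hornerZ mulrC [g.[x] * _]mulrC. Qed.

Lemma swapXY_tensor f g e d : swapXY (tensor f g e d) = tensor e d f g.
Proof.
rewrite /tensor rmorphB !rmorphM /= !swapXY_polyC !swapXY_map_polyC.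
by rewrite mulrC [_ * d%:P]mulrC.
Qed.

Lemma size_tensor f g e d n :
  (size e <= n)%N -> (size d <= n)%N -> (size (tensor f g e d) <= n)%N.
Proof.
move=> sze szd; apply: leq_trans (size_polyD _ _) _.
rewrite geq_max size_polyN !mul_polyC; apply/andP; split.
  by apply: leq_trans (size_scale_leq _ _) _; rewrite size_map_polyC.
by apply: leq_trans (size_scale_leq _ _) _; rewrite size_map_polyC.
Qed.

Lemma sizeY_tensor f g e d n :
  (size f <= n)%N -> (size g <= n)%N -> (sizeY (tensor f g e d) <= n)%N.
Proof. by move=> szf szg; rewrite sizeYE swapXY_tensor size_tensor. Qed.

Definition independent f g :=
  forall a b : C, a *: f = b *: g -> a = 0 /\ b = 0.

(** At a root of the nonconstant one of the two, the other does not vanish; this kills one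
    coefficient of a linear relation, and then the other. *)
Lemma coprimep_independent f g :
  coprimep f g -> (1 < size f)%N || (1 < size g)%N -> independent f g.
Proof.
wlog szf : f g / (1 < size f)%N.
  move=> wl cop /orP[szf|szg]; first by apply: wl; rewrite ?szf.
  have ind : independent g f by apply: wl; rewrite ?szg // coprimep_sym.
  by move=> a b /esym/ind[].
move=> cop _ a b eqab.
have [c root_f] : exists c, root f c.
  by apply/closed_rootP; case: (size f) szf => [|[]].
have nz_gc := coprimep_root cop root_f.
have b0 : b = 0.
  move/(congr1 (horner^~ c)): eqab; rewrite !hornerZ (rootP root_f) mulr0 => /esym/eqP.
  by rewrite mulf_eq0 (negbTE nz_gc) orbF => /eqP.
split=> //; apply/eqP; move/eqP: eqab; rewrite b0 scale0r scaler_eq0.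
by case/orP => // /eqP f0; rewrite f0 size_poly0 in szf.
Qed.

(** At w = c the form is e(c) f - d(c) g, and e(c), d(c) are not both 0. *)
Lemma tensor_no_constant_root f g e d :
  independent f g -> coprimep e d -> no_constant_root (tensor f g e d).
Proof.
move=> ind cop c; rewrite tensor_horner subr_eq0; apply/eqP => /ind[e0 d0].
by have := coprimep_root cop (introT rootP e0); rewrite d0 eqxx.
Qed.

(** The resultant in w lies in the ideal of [A] and [B], so it vanishes at every z for which (z, phi
    z) is a common zero. It is nonzero by coprimality over C(z), and its degree bounds the number of
    such z. Later [phi] is conjugation. *)
Lemma common_zeros_leq A B n1 n2 (phi : C -> C) (s : seq C) :
    A != 0 -> B != 0 -> coprimep (frac_coefs A) (frac_coefs B) ->
    (0 < n1)%N -> (0 < n2)%N ->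
    (size A <= n1.+1)%N -> (sizeY A <= n1.+1)%N ->
    (size B <= n2.+1)%N -> (sizeY B <= n2.+1)%N ->
    uniq s -> {in s, forall z, A.[(phi z)%:P].[z] = 0 /\ B.[(phi z)%:P].[z] = 0} ->
  (size s <= 2 * n1 * n2)%N.
Proof.
move=> nzA nzB cop n1_gt0 n2_gt0 szA szYA szB szYB uniq_s zeros.
have zeros_leq f k : f != 0 -> (size f <= k.+1)%N ->
    {in s, forall z, f.[z] = 0} -> (size s <= k)%N.
  move=> nzf szf zf; rewrite -ltnS; apply: leq_trans szf.
  by apply: max_poly_roots => //; apply/allP => z /zf/rootP.
(* A polynomial without w is treated separately, since [resultant_in_ideal] requires positive degree
   in w; its zeros are roots of one polynomial in z. *)
have const P k : P != 0 -> (sizeY P <= k.+1)%N -> (size P <= 1)%N ->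
    {in s, forall z, P.[(phi z)%:P].[z] = 0} -> (size s <= k)%N.
  move=> nzP szYP /size1_polyC eqP zP; apply: (zeros_leq P`_0 k).
  - by apply: contraNneq nzP => P0; rewrite eqP P0 polyC0.
  - exact: leq_trans (max_size_coefXY _ _) szYP.
  by move=> z /zP; rewrite eqP hornerC coefC.
have [szA1|szA1] := leqP (size A) 1.
  apply: leq_trans (const A n1 nzA szYA szA1 (fun z zs => (zeros z zs).1)) _.
  by rewrite mulnC mulnA leq_pmull // muln_gt0 n2_gt0.
have [szB1|szB1] := leqP (size B) 1.
  apply: leq_trans (const B n2 nzB szYB szB1 (fun z zs => (zeros z zs).2)) _.
  by rewrite leq_pmull // muln_gt0.
have nzRes : resultant A B != 0.
  rewrite -iota_eq0 map_resultant ?iota_eq0 ?lead_coef_eq0 // resultant_eq0 -leqNgt.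
  by rewrite (eqP cop).
have [uv _ eqRes] := resultant_in_ideal szA1 szB1.
apply: (zeros_leq _ _ nzRes).
  apply: leq_trans (size_resultant szYA szYB) _; rewrite ltnS.
  rewrite -mulnA mul2n -addnn; apply: leq_add.
    by rewrite mulnC leq_mul // -subn1 leq_subLR.
  by rewrite leq_mul // -subn1 leq_subLR.
move=> z zs; have [Az Bz] := zeros z zs.
move/(congr1 (fun P => P.[(phi z)%:P].[z])): eqRes.
by rewrite hornerC hornerD !hornerM hornerD !hornerM Az Bz !mulr0 addr0.
Qed.

(** * Functions on the curve G = 0 and the Luroth argument *)

Lemma const_coefsM p q : const_coefs (p * q) = const_coefs p * const_coefs q.
Proof. by rewrite /const_coefs /frac_coefs !rmorphM. Qed.

Lemma const_coefsB p q : const_coefs (p - q) = const_coefs p - const_coefs q.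
Proof. by rewrite /const_coefs /frac_coefs !rmorphB. Qed.

Lemma const_coefs1 : const_coefs 1 = 1.
Proof. by rewrite /const_coefs /frac_coefs !rmorph1. Qed.

Lemma const_coefs0 : const_coefs 0 = 0.
Proof. by rewrite /const_coefs /frac_coefs !rmorph0. Qed.

Lemma frac_coefs_tensor f g e d :
  frac_coefs (tensor f g e d) = f%:F *: const_coefs e - g%:F *: const_coefs d.
Proof.
by rewrite /frac_coefs rmorphB !rmorphM /= !map_polyC /= !mul_polyC.
Qed.

(** [e] splits over C, so a divisor of it over C(z) is, up to a scalar, a product of factors w - c
    with c in C. A nonconstant such divisor has a constant root. *)
Lemma not_dvdp_const_coefs G e :
    no_constant_root G -> (1 < size G)%N -> e != 0 ->
  ~~ (frac_coefs G %| const_coefs e).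
Proof.
move=> nrG szG nze; apply/negP.
have [r eq_e] := closed_field_poly_normal e.
have -> : const_coefs e
    = (lead_coef e)%:P%:F *: \prod_(z <- r) ('X - (z%:P%:F)%:P).
  rewrite {1}eq_e -mul_polyC const_coefsM {1}/const_coefs /frac_coefs !map_polyC /=.
  rewrite mul_polyC; congr (_ *: _).
  rewrite /const_coefs /frac_coefs !rmorph_prod; apply: eq_bigr => z _.
  by rewrite !rmorphB /= !map_polyX !map_polyC.
rewrite dvdpZr ?iota_eq0 ?polyC_eq0 ?lead_coef_eq0 //.
case/dvdp_prod_XsubC => m; case: (mask m r) => [|z t] eqG.
  by move/eqp_size: eqG szG; rewrite big_nil size_poly1 size_frac_coefs => ->.
have : root (frac_coefs G) z%:P%:F.
  by rewrite (eqp_root eqG) big_cons rootM root_XsubC eqxx.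
by rewrite rootE horner_map iota_eq0 (negbTE (nrG z)).
Qed.

(* The elements of C(z) that agree on the curve G = 0 with a rational function
   d(w) / e(w). *)
Definition functions_of_w G (r : K) :=
  exists d e, e != 0 /\ frac_coefs G %| r *: const_coefs e - const_coefs d.

Lemma functions_of_w_subfield G :
  no_constant_root G -> (1 < size G)%N -> is_subfield (functions_of_w G).
Proof.
move=> nrG szG; split.
- by exists 1, 1; rewrite oner_neq0 scale1r subrr dvdp0.
- move=> x y [d1 [e1 [nz1 dv1]]] [d2 [e2 [nz2 dv2]]].
  exists (d1 * e2 - d2 * e1), (e1 * e2); split; first by rewrite mulf_neq0.
  have -> : (x - y) *: const_coefs (e1 * e2) - const_coefs (d1 * e2 - d2 * e1)
    = (x *: const_coefs e1 - const_coefs d1) * const_coefs e2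
      - (y *: const_coefs e2 - const_coefs d2) * const_coefs e1.
    rewrite const_coefsB !const_coefsM -!mul_polyC polyCB; ring.
  by rewrite dvdp_sub // dvdp_mulr.
- move=> x y [d1 [e1 [nz1 dv1]]] [d2 [e2 [nz2 dv2]]].
  exists (d1 * d2), (e1 * e2); split; first by rewrite mulf_neq0.
  have -> : (x * y) *: const_coefs (e1 * e2) - const_coefs (d1 * d2)
    = (x *: const_coefs e1 - const_coefs d1) * (y *: const_coefs e2)
      + (y *: const_coefs e2 - const_coefs d2) * const_coefs d1.
    rewrite !const_coefsM -!mul_polyC polyCM; ring.
  by rewrite dvdp_add // dvdp_mulr.
move=> x [d [e [nze dv]]]; have [->|nzx] := eqVneq x 0.
  by exists 0, 1; rewrite oner_neq0 invr0 scale0r const_coefs0 subrr dvdp0.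
(* The inverse is e / d; if [d] were 0, then [G] would divide the nonzero [e], which depends on w
   only. *)
exists e, d; split.
  apply: contraNneq (not_dvdp_const_coefs nrG szG nze) => d0.
  by move: dv; rewrite d0 const_coefs0 subr0 dvdpZr.
have -> : x^-1 *: const_coefs d - const_coefs e
    = - x^-1 *: (x *: const_coefs e - const_coefs d).
  by rewrite scalerBr scalerA mulNr mulVf // scaleN1r scaleNr opprK addrC.
by rewrite dvdpZr // oppr_eq0 invr_eq0.
Qed.

Lemma dvdp_functions_of_w G p q r s : q != 0 -> r != 0 ->
  frac_coefs G %| frac_coefs (tensor p q r s) -> functions_of_w G (p%:F / q%:F).
Proof.
move=> nzq nzr dv; exists s, r; split=> //.
rewrite -(@dvdpZr _ (q%:F)) ?iota_eq0 // scalerBr scalerA mulrC divfK ?iota_eq0 //.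
by rewrite -frac_coefs_tensor.
Qed.

Lemma const_coefs_in (S : K -> Prop) e :
  (forall c : C, S c%:P%:F) -> coefs_in S (const_coefs e).
Proof. by move=> Sc i; rewrite /const_coefs /frac_coefs !coef_map /=; apply: Sc. Qed.

Lemma functions_of_w_const G c : functions_of_w G c%:P%:F.
Proof.
exists c%:P, 1; rewrite oner_neq0 const_coefs1 /const_coefs /frac_coefs.
by rewrite map_polyC /= map_polyC /= alg_polyC subrr dvdp0.
Qed.

(* The monic gcd is computed inside the field generated by the p_i / q_i, which
   are functions of w on the curve. *)
Lemma gcdp_coefs_functions_of_w G p1 q1 r1 s1 p2 q2 r2 s2 j :
    no_constant_root G -> (1 < size G)%N ->
    q1 != 0 -> r1 != 0 -> q2 != 0 -> r2 != 0 ->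
    frac_coefs G %= gcdp (frac_coefs (tensor p1 q1 r1 s1))
                         (frac_coefs (tensor p2 q2 r2 s2)) ->
  functions_of_w G ((G`_j)%:F / (lead_coef G)%:F).
Proof.
move=> nrG szG nzq1 nzr1 nzq2 nzr2 eqG.
have Sfield := functions_of_w_subfield nrG szG.
(* The form divided by [q]: its coefficients are C-linear combinations of p / q and 1. *)
pose monic_in p q r s : {poly K} := (p%:F / q%:F) *: const_coefs r - const_coefs s.
have tensorE p q r s : q != 0 -> monic_in p q r s %= frac_coefs (tensor p q r s).
  move=> nzq; rewrite eqp_sym.
  have -> : frac_coefs (tensor p q r s) = q%:F *: monic_in p q r s.
    by rewrite frac_coefs_tensor scalerBr scalerA [q%:F * _]mulrC divfK ?iota_eq0.
  by rewrite eqp_scale ?iota_eq0.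
have monicS p q r s : functions_of_w G (p%:F / q%:F) ->
    coefs_in (functions_of_w G) (monic_in p q r s).
  move=> Spq i; rewrite coefB coefZ; apply: subfieldB => //.
    apply: subfieldM => //.
    by apply: const_coefs_in; apply: functions_of_w_const.
  by apply: const_coefs_in; apply: functions_of_w_const.
have [||g Sg eq_g] :=
  @coefs_in_gcdp _ _ Sfield (monic_in p1 q1 r1 s1) (monic_in p2 q2 r2 s2).
- apply: monicS; apply: (@dvdp_functions_of_w _ _ _ r1 s1) => //.
  by rewrite (eqp_dvdl _ eqG) dvdp_gcdl.
- apply: monicS; apply: (@dvdp_functions_of_w _ _ _ r2 s2) => //.
  by rewrite (eqp_dvdl _ eqG) dvdp_gcdr.
(* [G] and [g] differ by an unknown scalar [k], which cancels in the ratio to the leading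
   coefficient. *)
have : frac_coefs G %= g.
  apply: eqp_trans eqG _; rewrite eqp_sym; apply: eqp_trans eq_g _.
  by apply: eqp_gcd; apply: tensorE.
case/eqpf_eq => k nzk eqGg.
have coefE i : (G`_i)%:F = k * g`_i.
  by rewrite -coefZ -eqGg /frac_coefs coef_map.
rewrite lead_coefE !coefE invfM mulrACA divff // mul1r.
by apply: subfieldM => //; apply: subfieldV.
Qed.

(** If every coefficient were a constant multiple of the leading one, [G] would be [lead_coef G]
    times a nonconstant e(w), and a root of e would be a constant root of [G]. *)
Lemma nonconstant_coef_ratio G :
    no_constant_root G -> (1 < size G)%N ->
  exists j, forall c, G`_j != c *: lead_coef G.
Proof.
move=> nrG szG; apply: boolp.contrapT => /boolp.forallNP allj.
have /boolp.choice[c eqc] : forall j, exists c, G`_j = c *: lead_coef G.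
  move=> j; have /boolp.existsNP[c /negP] := allj j.
  by rewrite negbK => /eqP; exists c.
have nzG := no_constant_root_neq0 nrG.
pose e := \poly_(j < size G) c j.
have eqG : G = (lead_coef G)%:P * e^:P.
  apply/polyP => j; rewrite mul_polyC coefZ coef_map coef_poly /=.
  have [ltj|lej] := ltnP j (size G); first by rewrite mulrC mul_polyC.
  by rewrite nth_default // polyC0 mulr0.
have [z root_e] : exists z, root e z.
  apply/closed_rootP; apply: contraTneq szG => sze.
  by rewrite eqG mul_polyC size_scale ?lead_coef_eq0 // size_map_polyC sze.
by have := nrG z; rewrite eqG hornerM horner_map /= (rootP root_e) polyC0 mulr0 eqxx.
Qed.

Lemma nonconstant_ratio_lowest_terms (a b : {poly C}) n :
    b != 0 -> (forall c, a != c *: b) -> (size a <= n)%N -> (size b <= n)%N ->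
  exists f g, [/\ coprimep f g, independent f g, g != 0,
    (size f <= n)%N /\ (size g <= n)%N & a%:F / b%:F = f%:F / g%:F].
Proof.
move=> nzb nconst sza szb; set h := gcdp a b.
have nzh : h != 0 by rewrite gcdp_eq0 (negbTE nzb) andbF.
pose f := a %/ h; pose g := b %/ h.
have eqa : a = f * h by rewrite divpK ?dvdp_gcdl.
have eqb : b = g * h by rewrite divpK ?dvdp_gcdr.
have nzg : g != 0 by apply: contraNneq nzb => g0; rewrite eqb g0 mul0r.
have cop : coprimep f g by rewrite coprimep_div_gcd // nzb orbT.
exists f, g; split => //.
- apply: coprimep_independent => //; apply/negPn; rewrite negb_or -!leqNgt.
  apply/negP => /andP[/size1_polyC eqf /size1_polyC eqg].
  have nz_g0 : g`_0 != 0 by apply: contraNneq nzg => g0; rewrite eqg g0 polyC0.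
  have /eqP := nconst (f`_0 / g`_0); apply.
  by rewrite eqa eqb -mul_polyC mulrA eqf eqg -polyCM coefC /= coefC /= divfK.
- by split; apply: leq_trans (leq_divp _ _) _.
by rewrite eqa eqb !rmorphM /= invfM mulrACA divff ?iota_eq0 ?mulr1.
Qed.

(* As f e - g d has degree at most that of G in z, the cofactor only depends on
   w, and its roots are common roots of e and d. *)
Lemma tensor_form G f g :
    no_constant_root G -> independent f g -> g != 0 ->
    no_constant_root (swapXY G) ->
    (size f <= sizeY G)%N -> (size g <= sizeY G)%N ->
    functions_of_w G (f%:F / g%:F) ->
  exists e d, G = tensor f g e d.
Proof.
move=> nrG ind nzg primG szf szg [d [e [nze dv]]].
have [H eqH] : exists H, tensor f g e d = G * H.
  apply: Gauss_dvdp_frac => //.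
  have -> : frac_coefs (tensor f g e d)
      = g%:F *: ((f%:F / g%:F) *: const_coefs e - const_coefs d).
    by rewrite frac_coefs_tensor scalerBr scalerA [g%:F * _]mulrC divfK ?iota_eq0.
  by rewrite dvdpZr ?iota_eq0.
have nzT e' d' : e' != 0 -> tensor f g e' d' != 0.
  move=> nze'; have /closed_nonrootP[c] := nze'; apply: contraNneq => T0.
  have := tensor_horner f g e' d' c; rewrite T0 horner0 => /esym/subr0_eq/ind[e0 _].
  exact/rootP.
have [h eq_h] : exists h, H = h^:P.
  have nzH : H != 0 by apply: contraNneq (nzT e d nze) => H0; rewrite eqH H0 mulr0.
  have szYH : (sizeY H <= 1)%N.
    have := sizeY_tensor e d szf szg.
    rewrite eqH sizeYE rmorphM /= size_mul ?swapXY_eq0 // ?no_constant_root_neq0 //.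
    rewrite -!sizeYE; have : (0 < sizeY G)%N.
      by rewrite lt0n sizeY_eq0 no_constant_root_neq0.
    by case: (sizeY G) => // m _; rewrite addSn /= -addn1 leq_add2l.
  exists (swapXY H)`_0; rewrite -[LHS]swapXYK -swapXY_polyC; congr swapXY.
  by apply: size1_polyC; rewrite -sizeYE.
rewrite {dv H}eq_h in eqH.
have [n] := ubnP (size h); elim: n => // n IHn in h e d nze eqH *.
move=> szh; have [/closed_rootP[c root_h]|] := boolP (size h != 1%N); last first.
  rewrite negbK => /size_poly1P[k nzk eq_h]; exists (k^-1 *: e), (k^-1 *: d).
  have -> : tensor f g (k^-1 *: e) (k^-1 *: d) = (k^-1)%:P%:P * tensor f g e d.
    rewrite /tensor -!mul_polyC !rmorphM /= map_polyC /= mulrBr.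
    by congr (_ - _); rewrite mulrCA.
  by rewrite eqH eq_h map_polyC /= mulrCA -!polyCM mulVf // !polyC1 mulr1.
(* A root c of the cofactor makes e(c) f - d(c) g vanish, so by independence w - c divides both [e]
   and [d] and can be removed. *)
have /ind[root_e root_d] : e.[c] *: f = d.[c] *: g.
  apply/subr0_eq; rewrite -tensor_horner eqH hornerM horner_map /= (rootP root_h).
  by rewrite polyC0 mulr0.
have /factor_theorem[e1 eq_e] : root e c by apply/rootP.
have /factor_theorem[d1 eq_d] : root d c by apply/rootP.
have /factor_theorem[h1 eq_h] := root_h.
apply: (IHn h1 e1 d1).
- by apply: contraNneq nze => e0; rewrite eq_e e0 mul0r.
- have nz_c : ('X - c%:P)^:P != 0 by rewrite map_polyC_eq0 polyXsubC_eq0.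
  apply: (mulIf nz_c); rewrite -mulrA -rmorphM /= -eq_h -eqH eq_e eq_d /tensor.
  by rewrite mulrBl !rmorphM !mulrA.
have nz_h1 : h1 != 0.
  apply: contraNneq (nzT e d nze) => h0.
  by rewrite eqH eq_h h0 mul0r map_poly0 mulr0.
by move: szh; rewrite eq_h size_Mmonic ?monicXsubC // size_XsubC addn2.
Qed.

(** * Rational expressions in f / g and their homogenization *)

Definition rational_in (c x : K) :=
  exists b1 b2, (const_coefs b2).[c] != 0
    /\ x = (const_coefs b1).[c] / (const_coefs b2).[c].

Lemma rational_in_subfield c : is_subfield (rational_in c).
Proof.
split.
- by exists 1, 1; rewrite const_coefs1 hornerC oner_neq0 divr1.
- move=> _ _ [b1 [b2 [nzb ->]]] [b3 [b4 [nzb' ->]]].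
  exists (b1 * b4 - b3 * b2), (b2 * b4).
  rewrite const_coefsB !const_coefsM hornerD hornerN !hornerM; split.
    by rewrite mulf_neq0.
  by field; rewrite nzb'.
- move=> _ _ [b1 [b2 [nzb ->]]] [b3 [b4 [nzb' ->]]]; exists (b1 * b3), (b2 * b4).
  rewrite !const_coefsM !hornerM; split; first by rewrite mulf_neq0.
  by rewrite mulrACA invfM.
move=> _ [b1 [b2 [nzb ->]]].
have [b10|nzb1] := eqVneq (const_coefs b1).[c] 0.
  exists 0, 1; rewrite const_coefs1 const_coefs0 hornerC horner0 oner_neq0.
  by rewrite b10 !mul0r invr0.
by exists b2, b1; rewrite invf_div.
Qed.

Lemma rational_in_const c k : rational_in c k%:P%:F.
Proof.
exists k%:P, 1; rewrite const_coefs1 hornerC oner_neq0 divr1.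
by rewrite /const_coefs /frac_coefs map_polyC /= map_polyC hornerC.
Qed.

(* Modulo M = c e - d, where c = f / g, the relation (p / q) r = s becomes an
   equality of remainders with coefficients in C(c). *)
Lemma dvdp_tensor_ratio f g e d p q r s :
    g != 0 -> q != 0 -> r != 0 ->
    no_constant_root (tensor f g e d) -> (1 < size (tensor f g e d))%N ->
    frac_coefs (tensor f g e d) %| frac_coefs (tensor p q r s) ->
  rational_in (f%:F / g%:F) (p%:F / q%:F).
Proof.
move=> nzg nzq nzr nrT szT; set c := f%:F / g%:F.
have Sfield := rational_in_subfield c.
set M := c *: const_coefs e - const_coefs d.
have tensorE : frac_coefs (tensor f g e d) = g%:F *: M.
  by rewrite frac_coefs_tensor scalerBr scalerA [g%:F * _]mulrC divfK ?iota_eq0.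
have -> : frac_coefs (tensor p q r s)
    = q%:F *: ((p%:F / q%:F) *: const_coefs r - const_coefs s).
  by rewrite frac_coefs_tensor scalerBr scalerA [q%:F * _]mulrC divfK ?iota_eq0.
have := not_dvdp_const_coefs nrT szT nzr.
rewrite tensorE !dvdpZl ?iota_eq0 // dvdpZr ?iota_eq0 //.
rewrite /dvdp modpD modpN modpZl subr_eq0.
set r1 := const_coefs r %% M; set s1 := const_coefs s %% M => nzr1 /eqP eqrs.
have Sconst b : coefs_in (rational_in c) (const_coefs b).
  by apply: const_coefs_in; apply: rational_in_const.
have SM : coefs_in (rational_in c) M.
  move=> i; rewrite coefB coefZ; apply: (subfieldB Sfield) (Sconst d i).
  apply: (subfieldM Sfield) (Sconst e i).
  exists 'X, 1; rewrite const_coefs1 hornerC oner_neq0 divr1.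
  by rewrite /const_coefs /frac_coefs !map_polyX hornerX.
(* From (p / q) r1 = s1 the ratio p / q is read off at the leading index of [r1], which is nonzero
   because [M] does not divide [r]. *)
have -> : p%:F / q%:F = s1`_(size r1).-1 / lead_coef r1.
  by rewrite -eqrs coefZ -lead_coefE mulfK ?lead_coef_eq0.
apply: subfieldM => //; first exact: coefs_in_modp.
by apply: subfieldV => //; rewrite lead_coefE; apply: coefs_in_modp.
Qed.

Definition homog n (b : {poly C}) f g :=
  \sum_(i < n.+1) b`_i *: (f ^+ i * g ^+ (n - i)).

Lemma homog_ratio n (b : {poly C}) f g : g != 0 -> (size b <= n.+1)%N ->
  (homog n b f g)%:F = g%:F ^+ n * (const_coefs b).[f%:F / g%:F].
Proof.
move=> nzg szb.
rewrite (@horner_coef_wide _ n.+1) ?size_frac_coefs ?size_map_polyC //.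
rewrite rmorph_sum mulr_sumr; apply: eq_bigr => i _.
rewrite -mul_polyC !rmorphM /= !rmorphXn /= /const_coefs /frac_coefs !coef_map /=.
rewrite [RHS]mulrCA; congr (_ * _); rewrite expr_div_n [RHS]mulrCA; congr (_ * _).
have le_in : (i <= n)%N by rewrite -ltnS.
apply: (canRL (mulfK _)); first by rewrite expf_neq0 // iota_eq0.
by rewrite -exprD subnK.
Qed.

(** [b1] and [b2] are put in lowest terms because they become numerator and denominator of B, and
    [n] is then the degree of B; multiplying by g^n clears the denominators. *)
Lemma rational_in_homog f g p q :
    g != 0 -> q != 0 -> rational_in (f%:F / g%:F) (p%:F / q%:F) ->
  exists b1 b2 n, [/\ coprimep b1 b2, b2 != 0, n = (maxn (size b1) (size b2)).-1
    & p * homog n b2 f g = q * homog n b1 f g].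
Proof.
move=> nzg nzq [c1 [c2 [nzc2 eqpq]]].
have nz2 : c2 != 0 by apply: contraNneq nzc2 => ->; rewrite const_coefs0 horner0.
set h := gcdp c1 c2; pose b1 := c1 %/ h; pose b2 := c2 %/ h.
have eq1 : c1 = b1 * h by rewrite divpK ?dvdp_gcdl.
have eq2 : c2 = b2 * h by rewrite divpK ?dvdp_gcdr.
move: nzc2 eqpq; rewrite eq1 eq2 !const_coefsM !hornerM mulf_eq0 negb_or.
case/andP => nzb2 nzh; rewrite -mulf_div divff // mulr1 => eqpq.
exists b1, b2, (maxn (size b1) (size b2)).-1; split => //.
- by rewrite coprimep_div_gcd // nz2 orbT.
- by apply: contraNneq nz2 => b20; rewrite eq2 b20 mul0r.
have nzFq : q%:F != 0 by rewrite iota_eq0.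
apply: iota_inj; rewrite !rmorphM /= !homog_ratio //.
- rewrite [LHS]mulrCA [RHS]mulrCA; congr (_ * _).
  by rewrite -[p%:F](divfK nzFq) eqpq mulrAC divfK // mulrC.
- by rewrite (leq_trans _ (leqSpred _)) // leq_maxl.
by rewrite (leq_trans _ (leqSpred _)) // leq_maxr.
Qed.

End BivariatePolynomials.

(* A Hermitian form X (a U + b V) - Y (c U + k V) in the coordinates
   F1 = x' X + y' Y and G1 = y X - x Y adapted to the vector (x, y); primes
   denote conjugates.  The coefficient of F1 S1 is the value of the form at
   (x, y). *)
Lemma isotropic_coordinates (R : comNzRingType)
    (a b c k x y a' b' c' k' x' y' X Y U V : R) :
  let F1 := x' * X + y' * Y in let G1 := y * X - x * Y in
  let S1 := x * U + y * V in let T1 := y' * U - x' * V in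
  let N := x * x' + y * y' in
  let Q := X * (a * U + b * V) - Y * (c * U + k * V) in
  let Q' := (a' * X + b' * Y) * U - (c' * X + k' * Y) * V in
  let A := x * (a * x' + b * y') - y * (c * x' + k * y') in
  let A' := x' * (a' * x + b' * y) - y' * (c' * x + k' * y) in
  let B := x * (a * y - b * x) - y * (c * y - k * x)
    + (y * (a' * x + b' * y) + x * (c' * x + k' * y)) in
  let B' := x' * (a' * y' - b' * x') - y' * (c' * y' - k' * x')
    + (y' * (a * x' + b * y') + x' * (c * x' + k * y')) in
  let D := y' * (a * y - b * x) + x' * (c * y - k * x)
    + (y * (a' * y' - b' * x') + x * (c' * y' - k' * x')) in
  let F2 := 2%:R * B * F1 + D * G1 in let S2 := 2%:R * B' * S1 + D * T1 in
  (F2 + G1) * (S2 + T1) - (F2 - G1) * (S2 - T1)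
    = 4%:R * N ^+ 2 * (Q + Q') - 4%:R * (A + A') * F1 * S1.
Proof. by rewrite /=; ring. Qed.

(** * Conjugation symmetry and reduction of Hermitian forms of rank 2 *)

Section HermitianPolynomials.

Variable C : numClosedFieldType.
Implicit Types (A B G H : {poly {poly C}}) (f g d e p q r : {poly C}).

(* The polynomial conj(A(conj(w), conj(z))); it has the same values as conj(A) at
   w = conj(z). *)
Definition star (A : {poly {poly C}}) := swapXY (map_poly (map_poly Num.conj) A).

HB.instance Definition _ :=
  GRing.RMorphism.copy star (swapXY \o map_poly (map_poly Num.conj)).

Definition conj_poly p : {poly C} := map_poly Num.conj p.
HB.instance Definition _ := GRing.RMorphism.copy conj_poly (map_poly Num.conj).

Lemma conj_polyK : involutive conj_poly.
Proof. by move=> p; apply/polyP => i; rewrite !coef_map /= conjCK. Qed.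

Lemma horner_conj_poly p z : (conj_poly p).[z^*] = p.[z]^*.
Proof. exact: horner_map. Qed.

Lemma starC p : star p%:P = (conj_poly p)^:P.
Proof. by rewrite /star map_polyC swapXY_polyC. Qed.

Lemma starK : involutive star.
Proof.
move=> A; apply/polyP => i; apply/polyP => j.
by rewrite /star coef_swapXY !coef_map coef_swapXY !coef_map /= conjCK.
Qed.

Lemma star_map A : star A = map_poly (map_poly Num.conj) (swapXY A).
Proof. exact: swapXY_map. Qed.

Lemma size_star A : size (star A) = sizeY A.
Proof.
rewrite star_map sizeYE size_map_inj_poly ?rmorph0 //.
exact: (can_inj conj_polyK).
Qed.

Lemma sizeY_star A : sizeY (star A) = size A.
Proof. by rewrite -size_star starK. Qed.

Lemma star_no_constant_root A :
  no_constant_root (star A) <-> no_constant_root (swapXY A).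
Proof.
have starE c : (star A).[c%:P] = map_poly Num.conj ((swapXY A).[(c^*)%:P]).
  by rewrite star_map -{1}[c]conjCK -map_polyC horner_map.
split=> nr c; last by rewrite starE map_poly_eq0.
by have := nr (c^*); rewrite starE conjCK map_poly_eq0.
Qed.

Lemma star_const (k : C) : star k%:P%:P = (k^*)%:P%:P.
Proof. by rewrite starC /conj_poly !map_polyC. Qed.

Lemma star_tensor f g e d :
  star (tensor f g e d)
    = tensor (conj_poly e) (conj_poly d) (conj_poly f) (conj_poly g).
Proof.
have starP p : star p^:P = (conj_poly p)%:P.
  by rewrite -[p]conj_polyK -starC starK conj_polyK.
by rewrite /tensor rmorphB !rmorphM /= !starC !starP mulrC [_ * _%:P]mulrC.
Qed.

(** The sum of [G] and [star G] is self-dual and equals (1 + l) G. When l = -1 it vanishes, and i G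
    is self-dual instead. *)
Lemma self_dual_multiple G (l : C) : G != 0 -> star G = l%:P%:P * G ->
  exists2 k, k != 0 & star (k%:P%:P * G) = k%:P%:P * G.
Proof.
move=> nzG starG; have [l1|nzl] := eqVneq (1 + l) 0.
  exists 'i; rewrite ?neq0Ci // rmorphM /= star_const starG conjCi.
  have -> : l = -1 by apply/eqP; rewrite -addr_eq0 addrC l1.
  by rewrite !polyCN !polyC1; ring.
exists (1 + l) => //.
have -> : (1 + l)%:P%:P * G = G + star G.
  by rewrite starG !polyCD !polyC1 mulrDl mul1r.
by rewrite rmorphD /= starK addrC.
Qed.

(** If all minors vanish, then g(x) f = f(x) g for every x, so independence forces f(x) = 0 for all
    x, hence f = 0, which contradicts independence. *)
Lemma independent_minor f g :
  independent f g -> exists x y, f.[x] * g.[y] - f.[y] * g.[x] != 0.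
Proof.
move=> ind; apply: boolp.contrapT => /boolp.forallNP allxy.
have f_root x : f.[x] = 0.
  suff /ind[] : g.[x] *: f = f.[x] *: g by [].
  apply/eqP; rewrite -subr_eq0; apply/negPn/negP => /closed_nonrootP[y].
  rewrite /root hornerD hornerN !hornerZ => /negP; apply.
  have /boolp.forallNP/(_ y)/negP := allxy x; rewrite negbK => /eqP /esym eq0.
  by apply/eqP; rewrite -[RHS]oppr0 eq0; ring.
have f0 : f = 0.
  by apply/eqP; apply/negPn/negP => /closed_nonrootP[y]; rewrite /root f_root eqxx.
have [] : (1 : C) = 0 /\ (0 : C) = 0 by apply: ind; rewrite f0 scaler0 scale0r.
by move/eqP; rewrite oner_eq0.
Qed.

(** Setting the inner variable to [x] and to [y] in the symmetry relation gives two linear equations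
    for [e] and [d] whose right sides are combinations of conj f and conj g. A nonzero minor lets
    Cramer's rule solve them; the witnesses are its formulas. *)
Lemma self_dual_tensor f g e d :
    independent f g -> star (tensor f g e d) = tensor f g e d ->
  exists a b c k, e = a *: conj_poly f + b *: conj_poly g
    /\ d = c *: conj_poly f + k *: conj_poly g.
Proof.
move=> ind starT; have [x [y nzD]] := independent_minor ind.
have eqT z : f.[z] *: e - g.[z] *: d
    = (conj_poly e).[z] *: conj_poly f - (conj_poly d).[z] *: conj_poly g.
  by rewrite -!tensor_horner -swapXY_tensor -starT star_tensor swapXY_tensor.
have eqTx := eqT x; have eqTy := eqT y.
set D := _ - _ in nzD; set u := conj_poly e in eqTx eqTy.
set v := conj_poly d in eqTx eqTy.
set fb := conj_poly f in eqTx eqTy *; set gb := conj_poly g in eqTx eqTy *.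
exists (D^-1 * (g.[y] * u.[x] - g.[x] * u.[y])),
  (- (D^-1 * (g.[y] * v.[x] - g.[x] * v.[y]))),
  (D^-1 * (f.[y] * u.[x] - f.[x] * u.[y])),
  (- (D^-1 * (f.[y] * v.[x] - f.[x] * v.[y]))).
split; apply: (scalerI nzD).
  have -> : D *: e = g.[y] *: (f.[x] *: e - g.[x] *: d)
      - g.[x] *: (f.[y] *: e - g.[y] *: d).
    rewrite -!mul_polyC /D polyCB !polyCM; ring.
  rewrite eqTx eqTy [RHS]scalerDr !scalerA mulrN !(mulVKf nzD).
  rewrite -!mul_polyC !polyCN !polyCB !polyCM; ring.
have -> : D *: d = f.[y] *: (f.[x] *: e - g.[x] *: d)
    - f.[x] *: (f.[y] *: e - g.[y] *: d).
  rewrite -!mul_polyC /D polyCB !polyCM; ring.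
rewrite eqTx eqTy [RHS]scalerDr !scalerA mulrN !(mulVKf nzD).
rewrite -!mul_polyC !polyCN !polyCB !polyCM; ring.
Qed.

Lemma rank_one_constant_root f e :
  no_constant_root (f%:P * e^:P) -> (size (f%:P * e^:P)%R <= 1)%N.
Proof.
move=> nr; have [/closed_rootP[c root_e]|] := boolP (size e != 1%N).
  by have := nr c; rewrite hornerM horner_map /= (rootP root_e) polyC0 mulr0 eqxx.
rewrite negbK => /eqP sze; rewrite mul_polyC.
by apply: leq_trans (size_scale_leq _ _) _; rewrite size_map_polyC sze.
Qed.

(** [G] is a Hermitian form in (f, g), and its zero at (z, conj z) makes (f(z), g(z)) an isotropic
    vector, to which [isotropic_coordinates] applies with [A] = 0. *)
Lemma indefinite_form f g e d z (G := tensor f g e d) :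
    coprimep f g -> independent f g -> star G = G ->
    no_constant_root G -> (1 < size G)%N -> G.[(z^*)%:P].[z] = 0 ->
  exists f3 g3 k, [/\ coprimep f3 g3, g3 != 0, k != 0 &
    k%:P%:P * G = tensor f3 g3 (conj_poly f3) (conj_poly g3)].
Proof.
move=> cop ind starG nrG szG.
have [a [b [c [k [eq_e eq_d]]]]] := self_dual_tensor ind starG.
pose cst (l : C) : {poly {poly C}} := l%:P%:P.
set x := f.[z]; set y := g.[z].
have GE : G = f%:P * (cst a * star f%:P + cst b * star g%:P)
    - g%:P * (cst c * star f%:P + cst k * star g%:P).
  by rewrite /G /tensor eq_e eq_d !starC -!mul_polyC !rmorphD !rmorphM /= !map_polyC.
have starGE : star G = (cst a^* * f%:P + cst b^* * g%:P) * star f%:P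
    - (cst c^* * f%:P + cst k^* * g%:P) * star g%:P.
  rewrite GE rmorphB !rmorphM !rmorphD !rmorphM /= !starK !star_const.
  by rewrite mulrC [star g%:P * _]mulrC.
set A := x * (a * x^* + b * y^*) - y * (c * x^* + k * y^*).
have -> : G.[(z^*)%:P].[z] = A.
  by rewrite tensor_horner2 eq_e eq_d !hornerD !hornerZ !horner_conj_poly.
move=> A0; have starA0 : A^* = 0 by rewrite A0 conjC0.
have := isotropic_coordinates (cst a) (cst b) (cst c) (cst k) (cst x) (cst y)
  (cst a^*) (cst b^*) (cst c^*) (cst k^*) (cst x^*) (cst y^*)
  f%:P g%:P (star f%:P) (star g%:P).
cbv zeta; rewrite -GE -starGE starG.
set N := x * x^* + y * y^*.
(* [N] is the squared length of (f(z), g(z)), and coprime [f], [g] have no common zero. *)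
have nzN : N != 0.
  have ge0 (u : C) : 0 <= u * u^* by rewrite -normCK exprn_ge0.
  rewrite paddr_eq0 ?ge0 // !mul_conjC_eq0; apply/negP => /andP[x0 y0].
  by have := coprimep_root cop x0; rewrite (negbTE (_ : ~~ (y != 0))) // negbK.
rewrite -[cst x * (cst a * cst x^* + _) - _](_ : cst A = _); last first.
  by rewrite /cst /A !(polyCN, polyCD, polyCM).
rewrite -[cst x^* * (cst a^* * cst x + _) - _](_ : cst A^* = _); last first.
  by rewrite /cst /A !(rmorphN, rmorphD, rmorphM) /= !conjCK.
have cst0 : cst 0 = 0 by rewrite /cst !polyC0.
rewrite starA0 A0 cst0 addr0 mulr0 !mul0r subr0.
pose B := x * (a * y - b * x) - y * (c * y - k * x)
  + (y * (a^* * x + b^* * y) + x * (c^* * x + k^* * y)).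
pose D := y^* * (a * y - b * x) + x^* * (c * y - k * x)
  + (y * (a^* * y^* - b^* * x^*) + x * (c^* * y^* - k^* * x^*)).
pose f1 := x^* *: f + y^* *: g; pose g1 := y *: f - x *: g.
pose f2 := (2%:R * B) *: f1 + D *: g1.
have f1E : f1%:P = cst x^* * f%:P + cst y^* * g%:P.
  by rewrite /f1 -!mul_polyC polyCD !polyCM.
have g1E : g1%:P = cst y * f%:P - cst x * g%:P.
  by rewrite /g1 -!mul_polyC polyCB !polyCM.
have f2E : f2%:P = 2%:R * cst B * f1%:P + cst D * g1%:P.
  by rewrite /f2 -!mul_polyC polyCD !polyCM !polyC_natr.
have starf1 : star f1%:P = cst x * star f%:P + cst y * star g%:P.
  by rewrite f1E rmorphD !rmorphM /= !star_const !conjCK.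
have starg1 : star g1%:P = cst y^* * star f%:P - cst x^* * star g%:P.
  by rewrite g1E rmorphB !rmorphM /= !star_const.
have starf2 : star f2%:P = 2%:R * cst B^* * star f1%:P + cst D * star g1%:P.
  have starD : D^* = D.
    rewrite /D !(rmorphD, rmorphN, rmorphM) /= !conjCK; ring.
  by rewrite f2E rmorphD !rmorphM /= !star_const starD rmorph_nat.
rewrite -f1E -g1E -starf1 -starg1.
rewrite -[X in 2%:R * X * f1%:P](_ : cst B = _); last first.
  by rewrite /cst /B !(polyCN, polyCD, polyCM).
rewrite -[X in 2%:R * X * star f1%:P](_ : cst B^* = _); last first.
  by rewrite /cst /B !(rmorphN, rmorphD, rmorphM) /= !conjCK.
have DE := erefl (cst D); rewrite {2}/cst /D !(polyCN, polyCD, polyCM) in DE.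
rewrite -[X in X * g1%:P]DE -[X in X * star g1%:P]DE.
rewrite -f2E -starf2.
have -> : cst x * cst x^* + cst y * cst y^* = cst N.
  by rewrite /cst /N !polyCD !polyCM.
(* In the identity both [Q] and its dual are [G], so the factor 4 N^2 is doubled. *)
move=> eqG; clearbody f2 g1; exists (f2 + g1), (f2 - g1), (8%:R * N ^+ 2).
have eqG' : (8%:R * N ^+ 2)%:P%:P * G
    = tensor (f2 + g1) (f2 - g1) (conj_poly (f2 + g1)) (conj_poly (f2 - g1)).
  have starD : star (f2 + g1)%:P = star f2%:P + star g1%:P by rewrite polyCD rmorphD.
  have starB : star (f2 - g1)%:P = star f2%:P - star g1%:P by rewrite polyCB rmorphB.
  rewrite /tensor -!starC starD starB polyCD polyCB eqG.
  by rewrite !polyCM !polyC_natr /cst; ring.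
have nzk : 8%:R * N ^+ 2 != 0 by rewrite mulf_neq0 ?pnatr_eq0 ?expf_neq0.
have nrG' : no_constant_root ((8%:R * N ^+ 2)%:P%:P * G).
  by move=> w; rewrite hornerM hornerC mulf_neq0 // polyC_eq0.
split=> //.
  (* A common root w of the new pair would make z = w a root of [G] for every value of the outer
     variable, against the dual of [nrG]. *)
  apply: Pdiv.ClosedField.root_coprimep => w /rootP root_f; apply/eqP => root_g.
  have : no_constant_root (swapXY G) by apply/star_no_constant_root; rewrite starG.
  move/(_ w)/eqP; apply; apply: (@mulfI _ (8%:R * N ^+ 2)%:P).
    by rewrite polyC_eq0.
  have := congr1 (fun A => (swapXY A).[w%:P]) eqG'.
  rewrite rmorphM /= swapXY_polyC map_polyC /= hornerM hornerC => ->.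
  by rewrite swapXY_tensor tensor_horner root_f root_g !scale0r subrr mulr0.
(* With [g3] = 0 the form would be a product f3(z) conj(f3)(w); without constant root it would not
   involve w. *)
apply: contraTneq szG => g3_0; rewrite -leqNgt.
have eqG1 : (8%:R * N ^+ 2)%:P%:P * G = (f2 + g1)%:P * (conj_poly (f2 + g1))^:P.
  by rewrite eqG' g3_0 /tensor mul0r subr0.
have := nrG'; rewrite eqG1 => /rank_one_constant_root.
by rewrite -eqG1 mul_polyC size_scale ?polyC_eq0.
Qed.

End HermitianPolynomials.

(** * The common component of two lemniscates *)

Section CommonComponent.

Variables (C : numClosedFieldType) (K : fieldType).
Variable iota : {rmorphism {poly C} -> K}.
Hypothesis iota_inj : injective iota.
Hypothesis iota_ratio : forall x, exists n d, d != 0 /\ x = iota n / iota d.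
Implicit Types (A B G H F : {poly {poly C}}) (f g d e p q r : {poly C}).

Local Notation frac := (frac_coefs iota).

Definition norm_form p q := tensor p q (conj_poly p) (conj_poly q).

Lemma star_norm_form p q : star (norm_form p q) = norm_form p q.
Proof. by rewrite /norm_form star_tensor !conj_polyK. Qed.

Lemma norm_form_horner2 p q z :
  (norm_form p q).[(z^*)%:P].[z] = `|p.[z]| ^+ 2 - `|q.[z]| ^+ 2.
Proof. by rewrite tensor_horner2 !horner_conj_poly !normCK. Qed.

Lemma coprimep_conj_poly p q : coprimep (conj_poly p) (conj_poly q) = coprimep p q.
Proof. exact: coprimep_map. Qed.

Lemma size_conj_poly p : size (conj_poly p) = size p.
Proof. exact: size_map_poly. Qed.

(** [star G] also divides both self-dual polynomials, hence divides [G]. Since [star] exchanges the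
    degrees in z and w, the cofactor is constant. *)
Lemma gcd_self_dual G F1 F2 :
    no_constant_root G -> no_constant_root (swapXY G) ->
    star F1 = F1 -> star F2 = F2 -> frac G %= gcdp (frac F1) (frac F2) ->
  exists l, star G = l%:P%:P * G.
Proof.
move=> nrG primG starF1 starF2 eqG.
have nzG := no_constant_root_neq0 nrG.
have dvd F : star F = F -> frac G %| frac F -> frac (star G) %| frac F.
  move=> starF /(Gauss_dvdp_frac iota_inj iota_ratio primG)[H eqF].
  by rewrite -starF eqF rmorphM /= frac_coefsM dvdp_mulIl.
have [H eqH] : exists H, G = star G * H.
  apply: (Gauss_dvdp_frac iota_inj iota_ratio).
    by apply/star_no_constant_root; rewrite starK.
  rewrite (eqp_dvdr _ eqG) dvdp_gcd.
  by rewrite !dvd // (eqp_dvdl _ eqG) ?dvdp_gcdl ?dvdp_gcdr.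
have nzH : H != 0 by apply: contraNneq nzG => H0; rewrite eqH H0 mulr0.
have nzS : star G != 0 by apply: contraNneq nzG => G0; rewrite eqH G0 mul0r.
have szH : size G = (sizeY G + size H).-1 by rewrite {1}eqH size_mul // size_star.
have szYH : sizeY G = (size G + sizeY H).-1.
  have nzSS : swapXY (star G) != 0 by rewrite (inv_eq swapXYK) rmorph0.
  have nzSH : swapXY H != 0 by rewrite swapXY_eq0.
  by rewrite {1}eqH sizeYE rmorphM /= size_mul // -!sizeYE sizeY_star.
have szG0 : (0 < size G)%N by rewrite lt0n size_poly_eq0.
have szYG0 : (0 < sizeY G)%N by rewrite lt0n sizeY_eq0.
have szH0 : (0 < size H)%N by rewrite lt0n size_poly_eq0.
have szYH0 : (0 < sizeY H)%N by rewrite lt0n sizeY_eq0.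
(* The sum of the two degree equations gives [size H + sizeY H = 2]. *)
have [szH1 szYH1] : (size H <= 1 /\ sizeY H <= 1)%N by lia.
have [k eq_k] : exists k, H = k%:P%:P.
  exists H`_0`_0; rewrite {1}(size1_polyC szH1); congr _%:P.
  by apply: size1_polyC; apply: leq_trans (max_size_coefXY _ _) szYH1.
have nzk : k != 0 by apply: contraNneq nzH => k0; rewrite eq_k k0 !polyC0.
by exists k^-1; rewrite {2}eqH eq_k mulrCA -!polyCM mulVf // !polyC1 mulr1.
Qed.

(** If [G] had no zero (z, conj z), all points of [s] would be common zeros of the coprime cofactors
    [H1] and [H2], too many for [common_zeros_leq]. *)
Lemma common_point G H1 H2 n1 n2 (s : seq C) :
    G * H1 != 0 -> G * H2 != 0 ->
    frac G %= gcdp (frac (G * H1)) (frac (G * H2)) ->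
    (0 < n1)%N -> (0 < n2)%N ->
    (size (G * H1)%R <= n1.+1)%N -> (sizeY (G * H1)%R <= n1.+1)%N ->
    (size (G * H2)%R <= n2.+1)%N -> (sizeY (G * H2)%R <= n2.+1)%N ->
    uniq s -> (2 * n1 * n2 < size s)%N ->
    {in s, forall z, (G * H1).[(z^*)%:P].[z] = 0 /\ (G * H2).[(z^*)%:P].[z] = 0} ->
  exists z, G.[(z^*)%:P].[z] = 0.
Proof.
move=> nz1 nz2 eqG n1_gt0 n2_gt0 sz1 szY1 sz2 szY2 uniq_s lt_s zeros.
have [nzG nzH1] : G != 0 /\ H1 != 0.
  by move: nz1; rewrite mulf_eq0 negb_or => /andP[].
have nzH2 : H2 != 0 by move: nz2; rewrite mulf_eq0 negb_or => /andP[].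
apply: boolp.contrapT => /boolp.forallNP nzero.
have := lt_s; rewrite ltnNge => /negP; apply.
have size_factor H n : H != 0 -> (size (G * H)%R <= n)%N -> (size H <= n)%N.
  move=> nzH; apply: leq_trans; rewrite size_mul //.
  have : (0 < size G)%N by rewrite lt0n size_poly_eq0.
  by case: (size G) => // m _; rewrite addSn /= leq_addl.
have sizeY_factor H n : H != 0 -> (sizeY (G * H)%R <= n)%N -> (sizeY H <= n)%N.
  move=> nzH; apply: leq_trans; rewrite !sizeYE rmorphM /= size_mul ?swapXY_eq0 //.
  rewrite -!sizeYE; have : (0 < sizeY G)%N by rewrite lt0n sizeY_eq0.
  by case: (sizeY G) => // m _; rewrite addSn /= leq_addl.
have cop : coprimep (frac H1) (frac H2).
  have nzFG : frac G != 0 by rewrite frac_coefs_eq0.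
  have : frac G %= frac G * gcdp (frac H1) (frac H2).
    by apply: eqp_trans eqG _; rewrite !frac_coefsM gcdp_mul2l.
  by rewrite -{1}[frac G]mulr1 eqp_mul2l // eqp_sym gcdp_eqp1.
apply: (common_zeros_leq iota_inj (phi := Num.conj) nzH1 nzH2 cop n1_gt0 n2_gt0
  (size_factor _ _ nzH1 sz1) (sizeY_factor _ _ nzH1 szY1)
  (size_factor _ _ nzH2 sz2) (sizeY_factor _ _ nzH2 szY2) uniq_s).
move=> z /zeros[]; rewrite !hornerM => /eqP + /eqP.
by rewrite !mulf_eq0 => /orP[/eqP/nzero//|/eqP ->] /orP[/eqP/nzero//|/eqP ->].
Qed.

Lemma common_decomposition p1 q1 p2 q2 n1 n2 (s : seq C) :
    coprimep p1 q1 -> coprimep p2 q2 -> q1 != 0 -> q2 != 0 ->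
    maxn (size p1) (size q1) = n1.+1 -> maxn (size p2) (size q2) = n2.+1 ->
    (0 < n1)%N -> (0 < n2)%N -> uniq s -> (2 * n1 * n2 < size s)%N ->
    {in s, forall z, `|p1.[z]| = `|q1.[z]| /\ `|p2.[z]| = `|q2.[z]|} ->
  exists f g, [/\ coprimep f g, g != 0,
    exists H1 H2, norm_form p1 q1 = norm_form f g * H1 /\
                  norm_form p2 q2 = norm_form f g * H2,
    rational_in iota (iota f / iota g) (iota p1 / iota q1) &
    rational_in iota (iota f / iota g) (iota p2 / iota q2)].
Proof.
move=> cop1 cop2 nzq1 nzq2 size1 size2 n1_gt0 n2_gt0 uniq_s lt_s zeros.
have sizeP p q n : maxn (size p) (size q) = n.+1 -> (0 < n)%N ->
    [/\ (size p <= n.+1)%N, (size q <= n.+1)%N & (1 < size p)%N || (1 < size q)%N].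
  by move=> eqn n_gt0; split; lia.
have [szp1 szq1 sz1] := sizeP _ _ _ size1 n1_gt0.
have [szp2 szq2 sz2] := sizeP _ _ _ size2 n2_gt0.
have nrF p q : coprimep p q -> (1 < size p)%N || (1 < size q)%N ->
    no_constant_root (norm_form p q).
  move=> cop sz; apply: tensor_no_constant_root; first exact: coprimep_independent.
  by rewrite coprimep_conj_poly.
have nzp p q : coprimep p q -> (1 < size p)%N || (1 < size q)%N -> conj_poly p != 0.
  move=> cop sz; rewrite -size_poly_eq0 size_conj_poly size_poly_eq0.
  apply: contraTneq cop => p0; rewrite p0 coprime0p -size_poly_eq1.
  by move: sz; rewrite p0 size_poly0; case: (size q) => [|[]].
set F1 := norm_form p1 q1; set F2 := norm_form p2 q2.
have nrF1 : no_constant_root F1 := nrF _ _ cop1 sz1.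
have nrF2 : no_constant_root F2 := nrF _ _ cop2 sz2.
have nzF1 := no_constant_root_neq0 nrF1; have nzF2 := no_constant_root_neq0 nrF2.
have : gcdp (frac F1) (frac F2) != 0.
  by rewrite gcdp_eq0 !frac_coefs_eq0 // negb_and nzF1.
case/(primitive_part iota_inj iota_ratio) => G [primG eqG].
have gaussG F : frac G %| frac F -> exists H, F = G * H.
  exact: Gauss_dvdp_frac.
have [H1 eqF1] : exists H, F1 = G * H.
  by apply: gaussG; rewrite (eqp_dvdl _ eqG) dvdp_gcdl.
have [H2 eqF2] : exists H, F2 = G * H.
  by apply: gaussG; rewrite (eqp_dvdl _ eqG) dvdp_gcdr.
have [nrG _] : no_constant_root G /\ no_constant_root H1.
  by apply: no_constant_rootM; rewrite -eqF1.
have nzG := no_constant_root_neq0 nrG.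
have [z Gz] : exists z, G.[(z^*)%:P].[z] = 0.
  apply: (@common_point G H1 H2 n1 n2 s); rewrite -?eqF1 -?eqF2 //.
  - by rewrite size_tensor ?size_conj_poly.
  - by rewrite sizeY_tensor.
  - by rewrite size_tensor ?size_conj_poly.
  - by rewrite sizeY_tensor.
  by move=> x /zeros[eq1 eq2]; rewrite !norm_form_horner2 eq1 eq2 !subrr.
(* A [G] free of w would be a polynomial in z vanishing at the point found, so it would have a
   factor z - c although it is primitive. *)
have szG : (1 < size G)%N.
  rewrite ltnNge; apply/negP => /size1_polyC; move: (G`_0) => h eqG0.
  have := primG z; rewrite eqG0 swapXY_polyC horner_map /=.
  by move: Gz; rewrite eqG0 hornerC => ->; rewrite polyC0 eqxx.
(* The Luroth step: a nonconstant coefficient ratio of [G] is the candidate for f / g, before the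
   Hermitian change of coordinates. *)
have [j nconst_j] := nonconstant_coef_ratio nrG szG.
have Sj : functions_of_w iota G (iota G`_j / iota (lead_coef G)).
  exact: (gcdp_coefs_functions_of_w iota_inj j nrG szG
    nzq1 (nzp _ _ cop1 sz1) nzq2 (nzp _ _ cop2 sz2) eqG).
have nzl : lead_coef G != 0 by rewrite lead_coef_eq0.
have [f0 [g0 [cop0 ind0 nzg0 [szf0 szg0] eq_ratio]]] :=
  nonconstant_ratio_lowest_terms iota_inj nzl nconst_j (max_size_coefXY G j)
    (max_size_lead_coefXY G).
rewrite eq_ratio in Sj.
have [e [d eqGt]] :=
  tensor_form iota_inj iota_ratio nrG ind0 nzg0 primG szf0 szg0 Sj.
have [l starG] :=
  gcd_self_dual nrG primG (star_norm_form p1 q1) (star_norm_form p2 q2) eqG.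
have [k nzk starkG] := self_dual_multiple nzG starG.
have nzkP : k%:P != 0 :> {poly C} by rewrite polyC_eq0.
have eqkG : k%:P%:P * G = tensor f0 g0 (k *: e) (k *: d).
  rewrite eqGt /tensor -!mul_polyC !rmorphM /= map_polyC /= mulrBr.
  by congr (_ - _); rewrite mulrCA.
have nrkG : no_constant_root (k%:P%:P * G).
  by move=> c; rewrite hornerM hornerC mulf_neq0.
have szkG : (1 < size (k%:P%:P * G)%R)%N by rewrite mul_polyC size_scale.
have kGz : (k%:P%:P * G).[(z^*)%:P].[z] = 0 by rewrite hornerM hornerM Gz mulr0.
rewrite eqkG in starkG nrkG szkG kGz.
have [f [g [m [cop nzg nzm eqmG]]]] :=
  indefinite_form cop0 ind0 starkG nrkG szkG kGz.
rewrite -eqkG mulrA -!polyCM -/(norm_form f g) in eqmG.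
have nzmk : m * k != 0 by rewrite mulf_neq0.
have nzmkP : (m * k)%:P != 0 :> {poly C} by rewrite polyC_eq0.
have GE : G = ((m * k)^-1)%:P%:P * norm_form f g.
  by rewrite -eqmG mulrA -!polyCM mulVf // !polyC1 mul1r.
have nrT : no_constant_root (norm_form f g).
  by move=> c; rewrite -eqmG hornerM hornerC mulf_neq0.
have szT : (1 < size (norm_form f g))%N by rewrite -eqmG mul_polyC size_scale.
have dvdT p q H : norm_form p q = G * H ->
    frac (norm_form f g) %| frac (norm_form p q).
  by move=> ->; rewrite GE !frac_coefsM dvdp_mulr // dvdp_mull.
exists f, g; split => //.
- exists (((m * k)^-1)%:P%:P * H1), (((m * k)^-1)%:P%:P * H2).
  by rewrite ![norm_form f g * _]mulrCA !mulrA -GE.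
- exact: (dvdp_tensor_ratio iota_inj nzg nzq1 (nzp _ _ cop1 sz1) nrT szT
    (dvdT _ _ _ eqF1)).
exact: (dvdp_tensor_ratio iota_inj nzg nzq2 (nzp _ _ cop2 sz2) nrT szT
  (dvdT _ _ _ eqF2)).
Qed.

End CommonComponent.

(** * Rational maps in homogeneous coordinates *)

Section SphereMaps.

Variable R : realType.
Local Notation C := R[i].
Implicit Types (P B W : ratfun R) (f g p q b : {poly C}) (x y z : C).

(** The point with homogeneous coordinates [x : y]; the pair (0, 0) also gives infinity, so lemmas
    about it exclude that pair. *)
Definition sphere_point x y : sphere R := if y == 0 then None else Some (x / y).

Definition homog_at n b x y := \sum_(i < n.+1) b`_i * (x ^+ i * y ^+ (n - i)).

Lemma sphere_point_scale k x y :
  k != 0 -> sphere_point (k * x) (k * y) = sphere_point x y.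
Proof.
move=> nzk; rewrite /sphere_point mulf_eq0 (negbTE nzk) /=; case: eqP => // _.
by rewrite -mulf_div divff // mul1r.
Qed.

Lemma ratdeg_coef P : ((num P)`_(ratdeg P) != 0) || ((den P)`_(ratdeg P) != 0).
Proof.
rewrite /ratdeg; have [le|lt] := leqP (size (num P)).-1 (size (den P)).-1.
  by rewrite -lead_coefE lead_coef_eq0 den_neq0 orbT.
rewrite -lead_coefE lead_coef_eq0; apply/orP; left.
by apply: contraTneq lt => ->; rewrite size_poly0.
Qed.

Lemma size_num_ratdeg P : (size (num P) <= (ratdeg P).+1)%N.
Proof. by rewrite /ratdeg; lia. Qed.

Lemma size_den_ratdeg P : (size (den P) <= (ratdeg P).+1)%N.
Proof. by rewrite /ratdeg; lia. Qed.

Lemma ratmap_Some P z : P (Some z) = sphere_point (num P).[z] (den P).[z].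
Proof. by []. Qed.

Lemma ratmap_None P : P None = sphere_point (num P)`_(ratdeg P) (den P)`_(ratdeg P).
Proof.
have szd : (0 < size (den P))%N by rewrite lt0n size_poly_eq0 den_neq0.
rewrite /sphere_point /=; case: ltnP => [lt|le].
  have leq_max (a b : nat) : (a < b)%N -> (a <= maxn b.-1 a.-1)%N by lia.
  by rewrite [(den P)`_(ratdeg P)]nth_default ?eqxx // leq_max.
have -> : ratdeg P = (size (den P)).-1.
  by apply/maxn_idPr; rewrite -!subn1 leq_sub2r.
by rewrite -lead_coefE lead_coef_eq0 (negbTE (den_neq0 P)).
Qed.

Lemma homog_at_ratio n b x y : y != 0 -> (size b <= n.+1)%N ->
  homog_at n b x y = y ^+ n * b.[x / y].
Proof.
move=> nzy szb; rewrite (horner_coef_wide _ szb) mulr_sumr; apply: eq_bigr => i _.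
rewrite [RHS]mulrCA; congr (_ * _); rewrite expr_div_n [RHS]mulrCA; congr (_ * _).
apply: (canRL (mulfK _)); first by rewrite expf_neq0.
by rewrite -exprD subnK // -ltnS.
Qed.

Lemma homog_at_infinity n b x : homog_at n b x 0 = b`_n * x ^+ n.
Proof.
rewrite /homog_at big_ord_recr /= subnn mulr1 big1 ?add0r // => i _.
by rewrite expr0n subn_eq0 leqNgt ltn_ord /= !mulr0.
Qed.

Lemma ratmap_sphere_point B x y : (x != 0) || (y != 0) ->
  B (sphere_point x y)
    = sphere_point (homog_at (ratdeg B) (num B) x y)
                   (homog_at (ratdeg B) (den B) x y).
Proof.
rewrite {1}/sphere_point; have [->|nzy _] := eqVneq y 0.
  rewrite orbF => nzx.
  rewrite ratmap_None !homog_at_infinity ![_ * x ^+ _]mulrC.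
  by rewrite sphere_point_scale ?expf_neq0.
rewrite ratmap_Some !homog_at_ratio ?sphere_point_scale ?expf_neq0 //.
  exact: size_den_ratdeg.
exact: size_num_ratdeg.
Qed.

Lemma homog_at_neq0 B x y : (x != 0) || (y != 0) ->
  (homog_at (ratdeg B) (num B) x y != 0) || (homog_at (ratdeg B) (den B) x y != 0).
Proof.
have [->|nzy _] := eqVneq y 0.
  rewrite orbF => nzx; rewrite !homog_at_infinity !mulf_eq0 !negb_or.
  by rewrite expf_neq0 // !andbT ratdeg_coef.
rewrite !homog_at_ratio ?size_den_ratdeg ?size_num_ratdeg //.
rewrite !mulf_eq0 !negb_or expf_neq0 //= -negb_and; apply/negP => /andP[num0 den0].
by have := coprimep_root (Defs.coprime_num_den B) num0; rewrite den0.
Qed.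

Lemma coprimep_horner f g x : coprimep f g -> (f.[x] != 0) || (g.[x] != 0).
Proof.
move=> cop; rewrite -negb_and; apply/negP => /andP[f0 g0].
by have := coprimep_root cop f0; rewrite g0.
Qed.

(** Here [m] and [n] are only degree bounds. Values at infinity are read from the coefficients of
    index [ratdeg], which may vanish in the numerator or in the denominator. *)
Lemma top_coefM (S : nzRingType) (p q : {poly S}) m n :
    (size p <= m.+1)%N -> (size q <= n.+1)%N ->
  (p * q)`_(m + n) = p`_m * q`_n.
Proof.
move=> szp szq; rewrite coefM (bigD1 (inord m)) //= inordK ?ltnS ?leq_addr //.
rewrite addKn big1 ?addr0 // => j.
rewrite -val_eqE /= inordK ?ltnS ?leq_addr // => neq.
have [lt|lt|eqjm] := ltngtP j m; last by rewrite eqjm eqxx in neq.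
  rewrite [q`_ _]nth_default ?mulr0 //; apply: leq_trans szq _.
  by move: (nat_of_ord j) lt => i; lia.
by rewrite nth_default ?mul0r //; apply: leq_trans szp lt.
Qed.

Lemma size_exp_leq (S : nzRingType) (p : {poly S}) m n :
  (size p <= m.+1)%N -> (size (p ^+ n) <= (n * m).+1)%N.
Proof.
move=> szp; apply: leq_trans (size_poly_exp_leq _ _) _.
by rewrite ltnS mulnC leq_mul // -subn1 leq_subLR.
Qed.

Lemma top_coefX (S : nzRingType) (p : {poly S}) m n :
  (size p <= m.+1)%N -> (p ^+ n)`_(n * m) = p`_m ^+ n.
Proof.
move=> szp; elim: n => [|n IHn]; first by rewrite mul0n !expr0 coef1.
by rewrite !exprS mulSn top_coefM ?IHn // size_exp_leq.
Qed.

Lemma homog_horner n b f g z : (homog n b f g).[z] = homog_at n b f.[z] g.[z].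
Proof.
rewrite /homog horner_sum; apply: eq_bigr => i _.
by rewrite hornerZ hornerM !horner_exp.
Qed.

Lemma size_homog n b f g m : (size f <= m.+1)%N -> (size g <= m.+1)%N ->
  (size (homog n b f g) <= (n * m).+1)%N.
Proof.
move=> szf szg; apply: leq_trans (size_sum _ _ _) _; apply/bigmax_leqP => i _.
apply: leq_trans (size_scale_leq _ _) _; apply: leq_trans (size_polyMleq _ _) _.
have le_in : (i <= n)%N by rewrite -ltnS.
have leq_addP (k1 k2 l1 l2 l : nat) : (k1 <= l1.+1)%N -> (k2 <= l2.+1)%N ->
  (l1 + l2)%N = l -> ((k1 + k2).-1 <= l.+1)%N by lia.
apply: leq_addP (size_exp_leq i szf) (size_exp_leq (n - i) szg) _.
by rewrite -mulnDl subnKC.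
Qed.

Lemma coef_homog n b f g m : (size f <= m.+1)%N -> (size g <= m.+1)%N ->
  (homog n b f g)`_(n * m) = homog_at n b f`_m g`_m.
Proof.
move=> szf szg; rewrite /homog coef_sum; apply: eq_bigr => i _.
have le_in : (i <= n)%N by rewrite -ltnS.
have -> : (n * m = i * m + (n - i) * m)%N by rewrite -mulnDl subnKC.
by rewrite coefZ top_coefM ?size_exp_leq // !top_coefX.
Qed.

(** Both sides of the cross-multiplied equation are fractions in lowest terms, so numerators and
    denominators agree up to one scalar. This settles finite points and, once the degree of [P] is
    known, infinity. *)
Lemma ratmap_comp P B W :
    num P * homog (ratdeg B) (den B) (num W) (den W)
      = den P * homog (ratdeg B) (num B) (num W) (den W) ->
  P =1 B \o W.
Proof.
set f := num W; set g := den W; set n := ratdeg B; set m := ratdeg W.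
set bf := homog n (num B) f g; set cf := homog n (den B) f g => eqPB.
have szf : (size f <= m.+1)%N by apply: size_num_ratdeg.
have szg : (size g <= m.+1)%N by apply: size_den_ratdeg.
have cop : coprimep bf cf.
  apply: Pdiv.ClosedField.root_coprimep => z root_b; rewrite homog_horner.
  have := homog_at_neq0 B (coprimep_horner z (Defs.coprime_num_den W)).
  by rewrite -!homog_horner -/bf (rootP root_b) eqxx.
have copP := Defs.coprime_num_den P.
have : den P %= cf.
  rewrite /eqp; apply/andP; split.
    rewrite -(Gauss_dvdpr _ (_ : coprimep (den P) (num P))) 1?coprimep_sym //.
    by rewrite eqPB dvdp_mulIl.
  rewrite -(Gauss_dvdpl _ (_ : coprimep cf bf)) 1?coprimep_sym //.
  by rewrite -eqPB dvdp_mulIr.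
case/eqpf_eq => k nzk eq_den.
have nzc : cf != 0.
  by have := den_neq0 P; rewrite eq_den scaler_eq0 negb_or => /andP[].
have eq_num : num P = k *: bf.
  by apply: (mulIf nzc); rewrite eqPB eq_den -!scalerAl mulrC.
(* Multiplicativity of the degree ensures that the coefficients of [P] read at infinity are those
   given by [coef_homog]. *)
have degP : ratdeg P = (n * m)%N.
  have szb : (size bf <= (n * m).+1)%N by apply: size_homog.
  have szc : (size cf <= (n * m).+1)%N by apply: size_homog.
  have := homog_at_neq0 B (ratdeg_coef W).
  rewrite -/n -!(coef_homog _ _ szf szg) -/bf -/cf /ratdeg eq_num eq_den !size_scale //.
  have topE (h : {poly C}) : (size h <= (n * m).+1)%N -> h`_(n * m) != 0 ->
      size h = (n * m).+1.
    move=> szh; have [lt _|] := ltnP (n * m) (size h).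
      by apply/eqP; rewrite eqn_leq szh.
    by move/(nth_default 0) ->; rewrite eqxx.
  case/orP => [/(topE _ szb) ->|/(topE _ szc) ->] /=.
    by apply/maxn_idPl; rewrite -subn1 leq_subLR.
  by apply/maxn_idPr; rewrite -subn1 leq_subLR.
move=> z; rewrite -[RHS]/(B (W z)); case: z => [z|].
  rewrite (ratmap_Some W) ratmap_Some eq_num eq_den !hornerZ sphere_point_scale //.
  rewrite !homog_horner ratmap_sphere_point //.
  by rewrite coprimep_horner // Defs.coprime_num_den.
rewrite (ratmap_None W) ratmap_None degP eq_num eq_den !coefZ sphere_point_scale //.
by rewrite !(coef_homog _ _ szf szg) ratmap_sphere_point // ratdeg_coef.
Qed.

Lemma nonconstant_ratdeg P : nonconstant P -> (0 < ratdeg P)%N.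
Proof.
rewrite lt0n => ncP; apply/negP => /eqP deg0; apply: ncP.
exists (sphere_point (num P)`_0 (den P)`_0) => -[z|]; last first.
  by rewrite ratmap_None deg0.
have := size_num_ratdeg P; rewrite deg0 => /size1_polyC eq_num.
have := size_den_ratdeg P; rewrite deg0 => /size1_polyC eq_den.
by rewrite ratmap_Some {1}eq_num {1}eq_den !hornerC.
Qed.

Lemma ratdeg_size P : maxn (size (num P)) (size (den P)) = (ratdeg P).+1.
Proof.
have : (0 < size (den P))%N by rewrite lt0n size_poly_eq0 den_neq0.
rewrite /ratdeg; move: (size (num P)) (size (den P)) => k l; lia.
Qed.

Lemma lemniscateP P z : lemniscate P z <-> `|(num P).[z]| = `|(den P).[z]|.
Proof.
have nz := coprimep_horner z (Defs.coprime_num_den P); split.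
  case=> w; rewrite ratmap_Some /sphere_point; case: eqP => // /eqP nzd [<-].
  rewrite normrM normfV => /(congr1 (fun t => t * `|(den P).[z]|)).
  by rewrite mul1r divfK ?normr_eq0.
move=> eq_norm; have nzd : (den P).[z] != 0.
  by apply: contraTneq nz => d0; rewrite -normr_eq0 eq_norm d0 normr0 eqxx.
exists ((num P).[z] / (den P).[z]); first by rewrite /= (negbTE nzd).
by rewrite normrM normfV eq_norm divff ?normr_eq0.
Qed.

End SphereMaps.

(** * Preimages of the unit circle and the equivalence of the three conditions *)

Section CirclePreimages.

Variable R : realType.
Local Notation C := R[i].
Implicit Types (P B W : ratfun R) (f g p q b : {poly C}) (x y z u : C).

Lemma coef_tensor f g (e d : {poly C}) i :
  (tensor f g e d)`_i = e`_i *: f - d`_i *: g.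
Proof.
rewrite /tensor coefB !coefCM !coef_map /=.
by rewrite ![_ * _%:P]mulrC !mul_polyC.
Qed.

Lemma coef_norm_form f g i :
  (norm_form f g)`_i`_i = `|f`_i| ^+ 2 - `|g`_i| ^+ 2.
Proof.
rewrite coef_tensor coefB !coefZ /conj_poly !coef_map /= !normCK.
by rewrite mulrC [g`_i * _]mulrC.
Qed.

(** With n the degree of [P], the coefficient of w^n is conj(p_n) p - conj(q_n) q. It is nonzero
    since p and q are independent and p_n, q_n are not both 0. *)
Lemma size_norm_form P : (0 < ratdeg P)%N ->
  size (norm_form (num P) (den P)) = (ratdeg P).+1.
Proof.
move=> deg_gt0; apply/eqP; rewrite eqn_leq; apply/andP; split.
  by rewrite size_tensor // size_conj_poly ?size_num_ratdeg ?size_den_ratdeg.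
rewrite ltnNge; apply/negP => /(nth_default 0)/eqP.
rewrite coef_tensor subr_eq0 => /eqP; rewrite /conj_poly !coef_map /=.
have sz : (1 < size (num P))%N || (1 < size (den P))%N.
  have := ratdeg_size P; move: (size (num P)) (size (den P)) => k l; lia.
case/(coprimep_independent (Defs.coprime_num_den P) sz).
move=> /eqP + /eqP; rewrite !conjC_eq0 => num0 den0.
by have := ratdeg_coef P; rewrite num0 den0.
Qed.

Lemma sizeY_norm_form P :
  sizeY (norm_form (num P) (den P)) = size (norm_form (num P) (den P)).
Proof. by rewrite -size_star star_norm_form. Qed.

(** The counterpart at infinity of evaluating at (z, conj z): degrees add in each variable, so the
    coefficient of top bidegree is multiplicative, and for a norm form it is |p_n|^2 - |q_n|^2. *)
Lemma norm_form_dvd_infinity P W H :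
    (0 < ratdeg P)%N -> (0 < ratdeg W)%N ->
    norm_form (num P) (den P) = norm_form (num W) (den W) * H ->
    `|(num W)`_(ratdeg W)| = `|(den W)`_(ratdeg W)| ->
  `|(num P)`_(ratdeg P)| = `|(den P)`_(ratdeg P)|.
Proof.
move=> degP degW eqF eqW.
set F := norm_form _ _ in eqF; set T := norm_form (num W) _ in eqF.
have szF : size F = (ratdeg P).+1 by apply: size_norm_form.
have szT : size T = (ratdeg W).+1 by apply: size_norm_form.
have nzF : F != 0 by rewrite -size_poly_eq0 szF.
have [nzT nzH] : T != 0 /\ H != 0.
  by move: nzF; rewrite eqF mulf_eq0 negb_or => /andP.
have szYT : sizeY T = (ratdeg W).+1 by rewrite sizeY_norm_form.
have [h [szH szYH degE]] : exists h, [/\ size H = h.+1, sizeY H = h.+1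
    & ratdeg P = (ratdeg W + h)%N].
  have szM : size F = (size T + size H).-1 by rewrite eqF size_mul.
  have szYM : sizeY F = (sizeY T + sizeY H).-1.
    by rewrite eqF !sizeYE rmorphM /= size_mul // swapXY_eq0.
  rewrite sizeY_norm_form szYT -/F szF in szYM; rewrite szT szF in szM.
  have szH_gt0 : (0 < size H)%N by rewrite lt0n size_poly_eq0.
  exists (size H).-1; move: (size H) (sizeY H) szM szYM szH_gt0 => k l; split; lia.
have : F`_(ratdeg P)`_(ratdeg P) = 0.
  rewrite eqF degE !top_coefM ?szT ?szH //.
  - by rewrite coef_norm_form eqW subrr mul0r.
  - by rewrite -szYT max_size_coefXY.
  by rewrite -szYH max_size_coefXY.
rewrite coef_norm_form => /eqP; rewrite subr_eq0 => /eqP eq2.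
by apply/eqP; rewrite -(@eqrXn2 _ 2) // eq2.
Qed.

Lemma sphere_point_eq x y u : y != 0 -> x = u * y -> sphere_point x y = Some u.
Proof. by move=> nzy ->; rewrite /sphere_point (negbTE nzy) mulfK. Qed.

(** If num - u den has no root, it is a nonzero constant, so its coefficient of index [ratdeg W] > 0
    vanishes, which means that W takes the value u at infinity. *)
Lemma preimage_or_infinity W u : (0 < ratdeg W)%N ->
  (exists z, (den W).[z] != 0 /\ (num W).[z] = u * (den W).[z]) \/
  ((den W)`_(ratdeg W) != 0 /\ (num W)`_(ratdeg W) = u * (den W)`_(ratdeg W)).
Proof.
move=> degW; have cop := Defs.coprime_num_den W.
have [/closed_rootP[z root_z]|] := boolP (size (num W - u *: den W) != 1%N).
  left; exists z; move: root_z; rewrite rootE hornerD hornerN hornerZ subr_eq0.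
  move=> /eqP eqz; split=> //; have := coprimep_horner z cop.
  by rewrite eqz; apply: contraTneq => ->; rewrite mulr0 eqxx.
rewrite negbK => /eqP sz1; right; set m := ratdeg W.
have : (num W - u *: den W)`_m = 0 by rewrite nth_default // sz1.
rewrite coefB coefZ => /eqP; rewrite subr_eq0 => /eqP eqm; split=> //.
have := ratdeg_coef W; rewrite -/m eqm.
by apply: contraTneq => ->; rewrite mulr0 eqxx.
Qed.

(** Each u on the circle is W(z) for some z, possibly infinity. There the norm form of [W] vanishes,
    hence that of [P], so B(u) = P(z) lies on the circle. *)
Lemma preserves_circle_comp P B W H :
    (0 < ratdeg P)%N -> (0 < ratdeg W)%N -> P =1 B \o W ->
    norm_form (num P) (den P) = norm_form (num W) (den W) * H ->
  preserves_circle B.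
Proof.
move=> degP degW eqPB eqF _ [_ [u /= norm_u <-] <-].
suff [z Wz [x [y [Pz nz_xy norm_xy]]]] : exists2 z, W z = Some u &
    exists x y, [/\ P z = sphere_point x y, (x != 0) || (y != 0) & `|x| = `|y|].
  have nzy : y != 0.
    by apply: contraTneq nz_xy => y0; rewrite -normr_eq0 norm_xy y0 normr0 eqxx.
  rewrite -Wz -[B (W z)]/((B \o W) z) -eqPB Pz /sphere_point (negbTE nzy).
  exists (x / y) => //.
  by rewrite /unit_circle /= normrM normfV norm_xy divff ?normr_eq0.
have [[z [nzd eqz]]|[nzd eqm]] := preimage_or_infinity u degW.
  exists (Some z); first by rewrite ratmap_Some (sphere_point_eq nzd eqz).
  exists (num P).[z], (den P).[z]; split=> //.
    by rewrite coprimep_horner // Defs.coprime_num_den.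
  have /eqP : (norm_form (num P) (den P)).[(z^*)%:P].[z] = 0.
    rewrite eqF !hornerM norm_form_horner2 eqz normrM norm_u mul1r subrr.
    by rewrite mul0r.
  by rewrite norm_form_horner2 subr_eq0 eqrXn2 // => /eqP.
exists None; first by rewrite ratmap_None (sphere_point_eq nzd eqm).
exists (num P)`_(ratdeg P), (den P)`_(ratdeg P); split; first exact: ratmap_None.
  exact: ratdeg_coef.
by apply: norm_form_dvd_infinity eqF _ => //; rewrite eqm normrM norm_u mul1r.
Qed.

Lemma infinite_unit_circle : infinite_set (unit_circle R).
Proof.
(* The quotient of n + i by its conjugate has modulus 1, and distinct n give distinct points. *)
pose t (n : nat) : C := (n%:R + 'i) / (n%:R - 'i).
have conj_den n : (n%:R - 'i : C)^* = n%:R + 'i.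
  by rewrite rmorphB /= conjCi opprK rmorph_nat.
have nz n : n%:R - 'i != 0 :> C.
  apply/eqP => eq0; have := conj_den n; rewrite eq0 conjC0 => eq0'.
  have : 2%:R * 'i = 0 :> C by rewrite -[RHS](subrr 0) {1}eq0' -eq0; ring.
  by move/eqP; rewrite mulf_eq0 pnatr_eq0 (negbTE (neq0Ci _)).
have t_inj : injective t.
  move=> n m /eqP; rewrite /t eqr_div // -subr_eq0.
  have -> : (n%:R + 'i) * (m%:R - 'i) - (m%:R + 'i) * (n%:R - 'i)
      = 2%:R * 'i * (m%:R - n%:R) :> C by ring.
  by rewrite !mulf_eq0 pnatr_eq0 (negbTE (neq0Ci _)) subr_eq0 eqr_nat => /eqP.
apply: (@sub_infinite_set _ (range t)).
  move=> _ [n _ <-]; rewrite /unit_circle /= normrM normfV -conj_den norm_conjC.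
  by rewrite divff ?normr_eq0.
apply/infiniteP; rewrite -(card_le_eql (inj_card_eq (in2W t_inj))).
exact: subset_card_le.
Qed.

(** The finite points of the preimage cover the circle except possibly for the value of [W] at
    infinity. *)
Lemma infinite_circle_preimage W : (0 < ratdeg W)%N ->
  infinite_set [set z | exists2 u, unit_circle R u & W (Some z) = Some u].
Proof.
move=> degW fin; apply: infinite_unit_circle.
set X := mkset _ in fin.
have : finite_set ((fun z => (num W).[z] / (den W).[z]) @` X `|`
    [set (num W)`_(ratdeg W) / (den W)`_(ratdeg W)]).
  by rewrite finite_setU; split; [apply: finite_image | apply: finite_set1].
apply: sub_finite_set => u circ_u.
have [[z [nzd eqz]]|[nzd eqm]] := preimage_or_infinity u degW.
  left; exists z; last by rewrite eqz mulfK.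
  by exists u => //; rewrite ratmap_Some (sphere_point_eq nzd eqz).
by right; rewrite /= eqm mulfK.
Qed.

Lemma infinite_common_lemniscate P1 P2 W B1 B2 :
    (0 < ratdeg W)%N -> P1 =1 B1 \o W -> P2 =1 B2 \o W ->
    preserves_circle B1 -> preserves_circle B2 ->
  infinite_set (lemniscate P1 `&` lemniscate P2).
Proof.
move=> degW eqP1 eqP2 circ1 circ2.
apply: sub_infinite_set (infinite_circle_preimage degW) => z [u circ_u Wz].
have lemn P B : P =1 B \o W -> preserves_circle B -> lemniscate P z.
  move=> eqPB /(_ (B (Some u))) [].
    by exists (Some u) => //; exists u.
  move=> w circ_w eqw; exists w => //.
  by rewrite eqPB -[LHS]/(B (W (Some z))) Wz -eqw.
by split; [apply: lemn eqP1 circ1 | apply: lemn eqP2 circ2].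
Qed.

Lemma card_geq_seq (T : choiceType) (A : set T) n :
  (`I_n #<= A)%card ->
  exists s : seq T, [/\ uniq s, size s = n & {in s, forall a, A a}].
Proof.
case/card_subP => D cardD subD; exists (finmap.enum_fset (fset_set D)).
have finD : finite_set D by apply/finite_setP; exists n.
split; [exact: finmap.fset_uniq | exact: card_fset_set |].
by move=> x; rewrite in_fset_set // inE => /subD.
Qed.

Lemma lemniscates_decomposition P1 P2 :
    nonconstant P1 -> nonconstant P2 ->
    (`I_(2 * ratdeg P1 * ratdeg P2).+1 #<= lemniscate P1 `&` lemniscate P2)%card ->
  exists W B1 B2 : ratfun R,
    [/\ P1 =1 B1 \o W, P2 =1 B2 \o W, preserves_circle B1 & preserves_circle B2].
Proof.
move=> nc1 nc2 /card_geq_seq[s [uniq_s size_s in_s]].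
have deg1 := nonconstant_ratdeg nc1; have deg2 := nonconstant_ratdeg nc2.
pose iota : {rmorphism {poly C} -> {fraction {poly C}}} :=
  @FracField.tofrac {poly C}.
have iota_inj : injective iota by move=> p q /eqP; rewrite tofrac_eq => /eqP.
have iota_ratio := @fraction_ratio {poly C}.
have zeros : {in s, forall z, `|(num P1).[z]| = `|(den P1).[z]|
    /\ `|(num P2).[z]| = `|(den P2).[z]|}.
  by move=> z /in_s[/lemniscateP ? /lemniscateP ?].
have lt_s : (2 * ratdeg P1 * ratdeg P2 < size s)%N by rewrite size_s.
have [f [g [cop nzg [H1 [H2 [eqF1 eqF2]]] rat1 rat2]]] :=
  common_decomposition iota_inj iota_ratio
    (Defs.coprime_num_den P1) (Defs.coprime_num_den P2) (den_neq0 P1) (den_neq0 P2)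
    (ratdeg_size P1) (ratdeg_size P2) deg1 deg2 uniq_s lt_s zeros.
pose W := RatFun nzg cop.
have decomp P : rational_in iota (iota f / iota g) (iota (num P) / iota (den P)) ->
    exists B, P =1 B \o W.
  case/(rational_in_homog iota_inj nzg (den_neq0 P)).
  move=> b1 [b2 [n [copb nzb eqn eqPb]]].
  exists (RatFun nzb copb); apply: ratmap_comp => /=.
  have := ratdeg_size (RatFun nzb copb); rewrite /= => eqdeg.
  by rewrite eqdeg /= in eqn; rewrite -eqn.
have [B1 eqP1] := decomp _ rat1; have [B2 eqP2] := decomp _ rat2.
have degW : (0 < ratdeg W)%N.
  apply: nonconstant_ratdeg => -[c Wc]; apply: nc1; exists (B1 c) => z.
  by rewrite eqP1 -[LHS]/(B1 (W z)) Wc.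
exists W, B1, B2; split => //.
  exact: (@preserves_circle_comp P1 B1 W H1).
exact: (@preserves_circle_comp P2 B2 W H2).
Qed.

Lemma lemniscates_equivalence P1 P2 :
    nonconstant P1 -> nonconstant P2 ->
    ((`I_(2 * ratdeg P1 * ratdeg P2).+1 #<= lemniscate P1 `&` lemniscate P2)%card <->
      infinite_set (lemniscate P1 `&` lemniscate P2)) /\
    (infinite_set (lemniscate P1 `&` lemniscate P2) <->
      exists W B1 B2 : ratfun R,
        [/\ P1 =1 B1 \o W, P2 =1 B2 \o W,
            preserves_circle B1 & preserves_circle B2]).
Proof.
move=> nc1 nc2.
have inf_card : infinite_set (lemniscate P1 `&` lemniscate P2) ->
    (`I_(2 * ratdeg P1 * ratdeg P2).+1 #<= lemniscate P1 `&` lemniscate P2)%card.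
  by move/infiniteP; apply: card_le_trans; apply: subset_card_le.
have decomp_inf : (exists W B1 B2 : ratfun R,
    [/\ P1 =1 B1 \o W, P2 =1 B2 \o W, preserves_circle B1 & preserves_circle B2]) ->
    infinite_set (lemniscate P1 `&` lemniscate P2).
  case=> W [B1 [B2 [eqP1 eqP2 circ1 circ2]]].
  have degW : (0 < ratdeg W)%N.
    apply: nonconstant_ratdeg => -[c Wc]; apply: nc1; exists (B1 c) => z.
    by rewrite eqP1 -[LHS]/(B1 (W z)) Wc.
  exact: infinite_common_lemniscate degW eqP1 eqP2 circ1 circ2.
have card_decomp := lemniscates_decomposition nc1 nc2.
by split; split; auto.
Qed.

End CirclePreimages.

(** * Intersecting lines through 0 with circles through 1 and -1 *)

Section CirclesThroughTwoPoints.

Variable C : numClosedFieldType.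
Implicit Types (a s t u v w x y z zeta : C).

Lemma roots_Xn_minus1 n : (0 < n)%N ->
  exists r : seq C, [/\ uniq r, size r = n & forall x, (x \in r) = (x ^+ n == -1)].
Proof.
move=> n_gt0; pose p : {poly C} := 'X^n + 1.
have [r eqp] := closed_field_poly_normal p.
have lead1 : lead_coef p = 1 by apply/eqP; rewrite -monicE monicXnaddC.
rewrite lead1 scale1r in eqp.
have rootE x : root p x = (x ^+ n == -1).
  by rewrite rootE !hornerE addr_eq0.
exists r; split.
(* The roots are distinct: the derivative n X^(n-1) vanishes only at 0, which is no root of X^n +
   1. *)
- rewrite -separable_prod_XsubC -eqp separable_poly.unlock.
  apply: Pdiv.ClosedField.root_coprimep => x; rewrite rootE => /eqP xn.
  rewrite derivD derivXn -polyC1 derivC addr0 hornerMn hornerXn.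
  rewrite mulrn_eq0 negb_or -lt0n n_gt0 /= expf_neq0 //.
  apply: contraTneq (n_gt0) => x0; move: xn; rewrite x0 expr0n gtn_eqF //.
  by move=> /eqP; rewrite eq_sym oppr_eq0 oner_eq0.
- by apply/eqP; rewrite -eqSS -(size_prod_XsubC r id) -eqp /p -polyC1 size_XnaddC.
by move=> x; rewrite -rootE eqp root_prod_XsubC.
Qed.

Lemma norm1_root z n : (0 < n)%N -> z ^+ n = -1 -> z * z^* = 1.
Proof.
move=> n_gt0 zn; have := congr1 Num.norm zn.
rewrite normrX normrN normr1 => /eqP; rewrite pexpr_eq1 ?normr_ge0 // => /eqP norm1.
by rewrite -normCK norm1 expr1n.
Qed.

Lemma norm1_conj z : z * z^* = 1 -> z^* = z^-1.
Proof.
move=> zz; have nz : z != 0.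
  by apply: contra_eq_neq zz => ->; rewrite mul0r eq_sym oner_eq0.
by apply: (mulfI nz); rewrite zz divff.
Qed.

(** The Cayley transform, which sends the unit circle without 1 to the real line; its inverse is s
    -> (s + i) / (s - i). *)
Definition cayley u := 'i * (u + 1) / (u - 1).

Lemma cayley_real u : u * u^* = 1 -> u != 1 -> (cayley u)^* = cayley u.
Proof.
move=> uu nu1; rewrite /cayley fmorph_div !rmorphM rmorphD rmorphB rmorph1 /= conjCi.
have nzu : u != 0 by apply: contra_eq_neq uu => ->; rewrite mul0r eq_sym oner_eq0.
have nzu1 : u - 1 != 0 by rewrite subr_eq0.
have nz1u : 1 - u != 0 by rewrite -opprB oppr_eq0.
by rewrite norm1_conj //; field; rewrite nzu nzu1 mulN1r nz1u.
Qed.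

Lemma cayley_addi u : u != 1 -> cayley u + 'i = u * (cayley u - 'i).
Proof. by rewrite -subr_eq0 => nu1; rewrite /cayley; field. Qed.

Lemma cayleyK s u : s - 'i != 0 -> s + 'i = u * (s - 'i) -> s = cayley u.
Proof.
move=> nz equ; have eq2i : 2%:R * 'i = (u - 1) * (s - 'i).
  by rewrite mulrBl -equ; ring.
have nzu : u - 1 != 0.
  apply: contra_eq_neq eq2i => ->.
  by rewrite mul0r mulf_eq0 pnatr_eq0 (negbTE (neq0Ci _)).
apply: (mulIf nzu); rewrite /cayley divfK //.
have -> : s * (u - 1) = u * (s - 'i) + u * 'i - s by ring.
by rewrite -equ; ring.
Qed.

(** For real [a], the positive root of t^2 = a t + 1. *)
Definition radius a := (a + sqrtC (a ^+ 2 + 4%:R)) / 2%:R.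

Lemma real_sqr_ge0 a : a^* = a -> 0 <= a ^+ 2.
Proof. by move=> ra; rewrite -realEsqr CrealE ra. Qed.

Lemma radius_eq a : radius a ^+ 2 = a * radius a + 1.
Proof.
have := sqrtCK (a ^+ 2 + 4%:R); rewrite /radius; set r := sqrtC _ => eqr.
have -> : ((a + r) / 2%:R) ^+ 2 = (a ^+ 2 + 2%:R * a * r + r ^+ 2) / 4%:R by field.
by rewrite eqr; field.
Qed.

Lemma radius_gt0 a : a^* = a -> 0 < radius a.
Proof.
move=> ra; have real_a : a \is Num.real by rewrite CrealE ra.
have sqr_ge0 := real_sqr_ge0 ra.
have pos : 0 < a ^+ 2 + 4%:R by rewrite ltr_wpDl // ltr0n.
rewrite divr_gt0 ?ltr0n //; case/orP: real_a => [a_ge0|a_le0].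
  by rewrite ltr_wpDl // sqrtC_gt0.
rewrite addrC -[a in _ + a]opprK subr_gt0.
have : (- a) ^+ 2 < sqrtC (a ^+ 2 + 4%:R) ^+ 2 by rewrite sqrtCK sqrrN ltrDl ltr0n.
by rewrite ltr_pXn2r // nnegrE ?oppr_ge0 // sqrtC_ge0 ltW.
Qed.

Lemma radius_unique a t : a^* = a -> 0 < t -> t ^+ 2 = a * t + 1 -> t = radius a.
Proof.
move=> ra t_gt0 eqt; have nz2 : (2%:R : C) != 0 by rewrite pnatr_eq0.
have eqa : a = t - t^-1.
  apply: (mulIf (lt0r_neq0 t_gt0)).
  by rewrite mulrBl mulVf ?lt0r_neq0 // -expr2 eqt; ring.
apply: (mulIf nz2); rewrite divfK //.
have -> : a ^+ 2 + 4%:R = (t + t^-1) ^+ 2 by rewrite eqa; field; rewrite lt0r_neq0.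
by have t_ge0 := ltW t_gt0; rewrite sqrCK ?addr_ge0 ?invr_ge0 // eqa; ring.
Qed.

(* The points z with z^m + conj(z)^m = 0 form m lines through 0, and those with
   Re(((z - 1) conj(z + 1))^n) = 0 form n circles through 1 and -1.  The ray from
   0 in the direction zeta meets the circle |z|^2 - 2 s Im z = 1 once. *)
(* Twice the imaginary part. *)
Definition height zeta := 'i * (zeta^* - zeta).

Definition line_circle_point zeta u := radius (cayley u * height zeta) * zeta.

Section Intersection.

Variables m n : nat.
Hypotheses (m_gt0 : (0 < m)%N) (n_gt0 : (0 < n)%N).

(** On |zeta| = 1, multiplying zeta^m + conj(zeta)^m = 0 by zeta^m gives this equation; its 2m
    solutions are the directions of the rays forming the m lines. *)
Definition on_ray zeta := zeta ^+ (2 * m) == -1.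
(** Each of the n solutions stands for one circle, whose parameter s is [cayley u]. *)
Definition on_arc u := u ^+ n == -1.

Definition on_lines z := z ^+ m + z^* ^+ m == 0.
Definition on_circles z :=
  ((z - 1) * (z^* + 1)) ^+ n + ((z^* - 1) * (z + 1)) ^+ n == 0.

Lemma height_real zeta : (height zeta)^* = height zeta.
Proof. rewrite /height rmorphM rmorphB /= conjCi conjCK; ring. Qed.

Lemma ray_norm1 zeta : on_ray zeta -> zeta * zeta^* = 1.
Proof. by move/eqP; apply: norm1_root; rewrite muln_gt0. Qed.

Lemma ray_height_neq0 zeta : on_ray zeta -> height zeta != 0.
Proof.
move=> ray_z; have zz := ray_norm1 ray_z.
rewrite /height mulf_eq0 (negbTE (neq0Ci _)) subr_eq0 /=; apply/eqP => real_z.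
move: ray_z; rewrite /on_ray exprM expr2 -{2}real_z zz expr1n -subr_eq0 opprK.
by rewrite -(natrD _ 1 1) pnatr_eq0.
Qed.

Lemma arc_norm1 u : on_arc u -> u * u^* = 1.
Proof. by move/eqP; apply: norm1_root. Qed.

Lemma arc_neq1 u : on_arc u -> u != 1.
Proof.
apply: contraTneq => ->; rewrite /on_arc expr1n -subr_eq0 opprK.
by rewrite -(natrD _ 1 1) pnatr_eq0.
Qed.

Lemma slope_real zeta u : on_arc u ->
  (cayley u * height zeta)^* = cayley u * height zeta.
Proof.
move=> cu; rewrite rmorphM /= height_real cayley_real //.
  exact: arc_norm1.
exact: arc_neq1.
Qed.

Lemma cayley_subi_neq0 u : on_arc u -> cayley u - 'i != 0.
Proof.
move=> /arc_neq1 nu1; have nzu1 : u - 1 != 0 by rewrite subr_eq0.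
have -> : cayley u - 'i = 2%:R * 'i / (u - 1) by rewrite /cayley; field.
by rewrite !mulf_neq0 ?invr_eq0 ?pnatr_eq0 ?neq0Ci.
Qed.

(** Up to the real factor t h, the product is s + i and its conjugate is s - i, so [on_circles]
    becomes a condition on ((s + i) / (s - i))^n. *)
Lemma factor_on_circle t zeta s (h := height zeta) : zeta * zeta^* = 1 ->
  t^* = t -> t ^+ 2 = s * h * t + 1 ->
  (t * zeta - 1) * ((t * zeta)^* + 1) = t * h * (s + 'i).
Proof.
move=> zz rt eqt; rewrite rmorphM /= rt.
have -> : (t * zeta - 1) * (t * zeta^* + 1)
    = t ^+ 2 * (zeta * zeta^*) - 1 + t * (zeta - zeta^*) by ring.
rewrite zz mulr1 eqt addrK /h /height.
have -> : zeta - zeta^* = 'i * 'i * (zeta^* - zeta) by rewrite -expr2 sqrCi; ring.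
by ring.
Qed.

Lemma conj_factor z :
  ((z - 1) * (z^* + 1))^* = (z^* - 1) * (z + 1).
Proof. by rewrite rmorphM rmorphB rmorphD /= conjCK rmorph1. Qed.

Lemma conj_real_factor t h s :
  t^* = t -> h^* = h -> s^* = s -> (t * h * (s + 'i))^* = t * h * (s - 'i).
Proof. by move=> rt rh rs; rewrite !rmorphM rmorphD /= conjCi rt rh rs. Qed.

Lemma radius_real zeta u : on_arc u ->
  (radius (cayley u * height zeta))^* = radius (cayley u * height zeta).
Proof.
by move=> /slope_real/radius_gt0 r_gt0; apply: (CrealP (gtr0_real (r_gt0 zeta))).
Qed.

Lemma line_circle_point_on zeta u : on_ray zeta -> on_arc u ->
  on_lines (line_circle_point zeta u) /\ on_circles (line_circle_point zeta u).
Proof.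
move=> ray_z arc_u; rewrite /line_circle_point.
have rt := radius_real zeta arc_u; have eqt := radius_eq (cayley u * height zeta).
set t := radius _ in rt eqt *; have zz := ray_norm1 ray_z.
have nz : zeta != 0 by apply: contra_eq_neq zz => ->; rewrite mul0r eq_sym oner_eq0.
split.
  rewrite /on_lines rmorphM /= rt !exprMn -mulrDr mulf_eq0; apply/orP; right.
  rewrite -(mulIr_eq0 _ (mulIf (expf_neq0 m nz))) mulrDl -exprD addnn -mul2n.
  by rewrite (eqP ray_z) -exprMn [zeta^* * _]mulrC zz expr1n addNr.
have rs : (cayley u)^* = cayley u by rewrite cayley_real ?arc_norm1 ?arc_neq1.
rewrite /on_circles -conj_factor (factor_on_circle zz rt eqt).
rewrite conj_real_factor ?height_real // cayley_addi ?arc_neq1 //.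
rewrite !exprMn (eqP arc_u).
by rewrite mulN1r mulrN addNr.
Qed.

(** The modulus of the point gives the radius and its direction gives [zeta]; as [height zeta] is
    nonzero, the quadratic equation of the radius then determines [cayley u], hence u. *)
Lemma line_circle_point_inj zeta u zeta' u' :
    on_ray zeta -> on_arc u -> on_ray zeta' -> on_arc u' ->
    line_circle_point zeta u = line_circle_point zeta' u' ->
  zeta = zeta' /\ u = u'.
Proof.
move=> ray_z arc_u ray_z' arc_u'; rewrite /line_circle_point.
have t_gt0 := radius_gt0 (slope_real zeta arc_u).
have t'_gt0 := radius_gt0 (slope_real zeta' arc_u').
have eqt := radius_eq (cayley u * height zeta).
have eqt' := radius_eq (cayley u' * height zeta').
set t := radius (cayley u * _) in t_gt0 eqt *.
set t' := radius (cayley u' * _) in t'_gt0 eqt' *.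
clearbody t t'; move=> eq_z; have norm1 x : on_ray x -> `|x| = 1.
  by move/ray_norm1/eqP; rewrite -normCK pexpr_eq1 ?normr_ge0 // => /eqP.
have ett : t = t'.
  move/(congr1 Num.norm): eq_z.
  by rewrite !normrM (norm1 _ ray_z) (norm1 _ ray_z') !mulr1 !gtr0_norm.
rewrite -ett in eq_z eqt'; have ez := mulfI (lt0r_neq0 t_gt0) eq_z.
split=> //; rewrite -ez in eqt'.
have ec : cayley u = cayley u'.
  apply: (mulIf (ray_height_neq0 ray_z)); apply: (mulIf (lt0r_neq0 t_gt0)).
  by apply: (addIr 1); rewrite -eqt -eqt'.
apply: (mulIf (cayley_subi_neq0 arc_u)); rewrite -cayley_addi ?arc_neq1 //.
by rewrite ec cayley_addi // arc_neq1.
Qed.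

(** In polar form z = t zeta, the real number s is solved from t^2 = s h t + 1, and u is its inverse
    Cayley image. Positivity of t selects the root [radius]. *)
Lemma line_circle_point_surj z : on_lines z -> on_circles z ->
  exists zeta u, [/\ on_ray zeta, on_arc u & z = line_circle_point zeta u].
Proof.
move=> lin_z cir_z; have nz : z != 0.
  apply: contraTneq cir_z => ->; rewrite /on_circles conjC0 !add0r mulN1r.
  by rewrite -mulr2n mulrn_eq0 /= signr_eq0.
have t_gt0 : 0 < `|z| by rewrite normr_gt0.
have nzt := lt0r_neq0 t_gt0; have rt : `|z|^* = `|z| by apply/CrealP/normr_real.
set t := `|z| in t_gt0 nzt rt; pose zeta := z / t.
have zE : z = t * zeta by rewrite mulrC divfK.
have zz : zeta * zeta^* = 1.
  rewrite /zeta fmorph_div /= rt mulf_div -normCK -/t -expr2 divff // expf_neq0 //.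
clearbody zeta t.
have ray_z : on_ray zeta.
  move: lin_z; rewrite /on_lines zE rmorphM /= rt !exprMn -mulrDr mulf_eq0.
  rewrite expf_eq0 (negbTE nzt) andbF /= => /eqP eq0.
  rewrite /on_ray -subr_eq0 opprK.
  rewrite mul2n -addnn exprD -[1](expr1n _ m) -zz exprMn -mulrDr eq0 mulr0 //.
have nzh := ray_height_neq0 ray_z; have rh := height_real zeta.
have [s rs eqt] : exists2 s, s^* = s & t ^+ 2 = s * height zeta * t + 1.
  move: (height zeta) nzh rh => h nzh rh; exists ((t ^+ 2 - 1) / (h * t)).
    by rewrite fmorph_div rmorphB !rmorphM rmorph1 /= rt rh.
  by rewrite -mulrA divfK ?subrK // mulf_neq0.
have nzs : s - 'i != 0.
  rewrite subr_eq0; apply/eqP => si; move: rs; rewrite si conjCi => /eqP.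
  by rewrite eqNr (negbTE (neq0Ci _)).
pose u := (s + 'i) / (s - 'i).
have eqs : s = cayley u by apply: cayleyK; rewrite // divfK.
exists zeta, u; split => //.
  move: cir_z; rewrite /on_circles -conj_factor zE (factor_on_circle zz rt eqt).
  rewrite conj_real_factor //; move: (height zeta) nzh => h nzh.
  rewrite !exprMn -mulrDr mulf_eq0.
  rewrite mulf_eq0 !expf_eq0 (negbTE nzt) (negbTE nzh) !andbF /= => eq0.
  rewrite /on_arc /u expr_div_n -subr_eq0 opprK.
  rewrite -(mulIr_eq0 _ (mulIf (expf_neq0 n nzs))) mulrDl mul1r divfK //.
  by rewrite expf_neq0.
rewrite /line_circle_point -eqs -(radius_unique _ t_gt0 eqt) //.
by rewrite rmorphM /= rs rh.
Qed.

Lemma line_circle_points : exists r : seq C,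
  [/\ uniq r, size r = (2 * m * n)%N
    & forall z, (z \in r) = on_lines z && on_circles z].
Proof.
have [A [uniqA sizeA memA]] : exists A : seq C,
    [/\ uniq A, size A = (2 * m)%N & A =i on_ray].
  by apply: roots_Xn_minus1; rewrite muln_gt0.
have [B [uniqB sizeB memB]] := roots_Xn_minus1 n_gt0.
exists [seq line_circle_point zeta u | zeta <- A, u <- B]; split.
- apply: allpairs_uniq => // -[x y] [x' y'].
  move=> /allpairsP[[? ?] /= [Ax By [-> ->]]] /allpairsP[[? ?] /= [Ax' By' [-> ->]]].
  rewrite memA in Ax; rewrite memA in Ax'; rewrite memB in By; rewrite memB in By'.
  by case/(line_circle_point_inj Ax By Ax' By') => -> ->.
- by rewrite size_allpairs sizeA sizeB.
move=> z; apply/allpairsP/andP.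
  case=> -[x y] /= [Ax By ->]; rewrite memA in Ax; rewrite memB in By.
  exact: line_circle_point_on.
case=> /line_circle_point_surj/[apply] -[x [y [Ax By ->]]].
by exists (x, y); split; rewrite ?memA ?memB.
Qed.

End Intersection.

End CirclesThroughTwoPoints.

(** * Rational functions attaining the bound *)

Section ExtremalExample.

Variable R : realType.
Local Notation C := R[i].

Lemma coprimep_addsub (p q : {poly C}) : coprimep p q -> coprimep (p - q) (p + q).
Proof.
move=> cop; apply: Pdiv.ClosedField.root_coprimep => z.
rewrite rootE hornerD hornerN subr_eq0 hornerD => /eqP eqpq.
have := coprimep_horner z cop; rewrite eqpq orbb; apply: contra.
by rewrite -mulr2n mulrn_eq0.
Qed.

(** The right side says that x conj(y) has real part 0. This turns the lemniscate of (p - q) / (p +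
    q) into the equations [on_lines] and [on_circles]. *)
Lemma eq_norm_addsub (x y : C) : (`|x - y| == `|x + y|) = (x * y^* + x^* * y == 0).
Proof.
rewrite -(@eqrXn2 _ 2) // !normCK rmorphB rmorphD /= -subr_eq0.
have -> : (x - y) * (x^* - y^*) - (x + y) * (x^* + y^*)
    = - 2%:R * (x * y^* + x^* * y) by ring.
by rewrite mulf_eq0 oppr_eq0 pnatr_eq0.
Qed.

Lemma uniq_card_eq (T : eqType) (r : seq T) :
  uniq r -> ([set` r] #= `I_(size r))%card.
Proof.
case: r => [_|x0 r]; first by rewrite set_nil II0 card_eq0.
set s := x0 :: r => uniq_s.
have -> : [set` s] = nth x0 s @` `I_(size s).
  apply/seteqP; split=> [x /= xs|_ [i /= lt_i <-]]; last exact: mem_nth.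
  by exists (index x s); [rewrite -index_mem in xs | apply: nth_index].
apply: inj_card_eq => i j; rewrite !inE /= => lt_i lt_j eq_nth.
by apply/eqP; rewrite -(@nth_uniq _ x0 s i j) // eq_nth.
Qed.

(* P1 = (X^n1 - 1) / (X^n1 + 1) has n1 lines through 0 as lemniscate; that of
   P2 = (v - 1) / (v + 1), where v = ((X - 1) / (X + 1))^n2, is made of n2 circles. *)
Lemma extremal_lemniscates (n1 n2 : nat) : (1 <= n1)%N -> (1 <= n2)%N ->
  exists P1 P2 : ratfun R,
    [/\ ratdeg P1 = n1, ratdeg P2 = n2 &
        (lemniscate P1 `&` lemniscate P2 #= `I_(2 * n1 * n2))%card].
Proof.
move=> n1_gt0 n2_gt0.
have cop1 : coprimep ('X^n1 - 1 : {poly C}) ('X^n1 + 1).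
  by apply: coprimep_addsub; apply: coprimep1.
pose num2 : {poly C} := ('X - 1%:P) ^+ n2 - ('X + 1%:P) ^+ n2.
pose den2 : {poly C} := ('X - 1%:P) ^+ n2 + ('X + 1%:P) ^+ n2.
have cop2 : coprimep num2 den2.
  apply: coprimep_addsub; apply: coprimep_expl; apply: coprimep_expr.
  rewrite coprimep_sym coprimep_XsubC rootE !hornerE -(natrD _ 1 1) pnatr_eq0 //.
have size1 : size ('X^n1 + 1 : {poly C}) = n1.+1 by rewrite -polyC1 size_XnaddC.
have nz1 : 'X^n1 + 1 != 0 :> {poly C} by rewrite -size_poly_eq0 size1.
have size1' : size ('X^n1 - 1 : {poly C}) = n1.+1 by rewrite -polyC1 size_XnsubC.
have size_pow (p : {poly C}) : (size p <= 2)%N -> (size (p ^+ n2) <= n2.+1)%N.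
  by move=> szp; have := size_exp_leq n2 (szp : (size p <= 1.+1)%N); rewrite muln1.
have size_sub : (size ('X - 1%:P : {poly C})%R <= 2)%N by rewrite size_XsubC.
have size_add : (size ('X + 1%:P : {poly C})%R <= 2)%N by rewrite size_XaddC.
have size_num2 : (size num2 <= n2.+1)%N.
  apply: leq_trans (size_polyD _ _) _; rewrite size_polyN geq_max.
  by apply/andP; split; apply: size_pow.
have size_den2 : size den2 = n2.+1.
  apply/eqP; rewrite eqn_leq; apply/andP; split.
    apply: leq_trans (size_polyD _ _) _; rewrite geq_max.
    by apply/andP; split; apply: size_pow.
  (* The leading coefficients of (X - 1)^n2 and (X + 1)^n2 are both 1 and add up to 2 in [den2], so
     its degree is exactly [n2]. *)
  have topE (p : {poly C}) : (size p <= 2)%N -> (p ^+ n2)`_n2 = p`_1 ^+ n2.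
    by move=> szp; rewrite -(top_coefX n2 (szp : (size p <= 1.+1)%N)) muln1.
  rewrite ltnNge; apply/negP => /(nth_default 0)/eqP.
  rewrite coefD !topE // coefB coefD coefX !coefC subr0 addr0 expr1n.
  by rewrite -(natrD _ 1 1) pnatr_eq0.
have nz2 : den2 != 0 by rewrite -size_poly_eq0 size_den2.
exists (RatFun nz1 cop1), (RatFun nz2 cop2); split.
- by rewrite /ratdeg /= size1 size1' maxnn.
- rewrite /ratdeg /= size_den2; apply/maxn_idPr.
  by rewrite -subn1 leq_subLR.
have [r [uniq_r size_r mem_r]] := line_circle_points C n1_gt0 n2_gt0.
rewrite -size_r.
suff -> : lemniscate (RatFun nz1 cop1) `&` lemniscate (RatFun nz2 cop2) = [set` r].
  exact: uniq_card_eq.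
have linesE z : lemniscate (RatFun nz1 cop1) z <-> on_lines n1 z.
  rewrite lemniscateP /=; split=> [/eqP|].
    rewrite !hornerE /= eq_norm_addsub conjC1 !mulr1 /on_lines rmorphXn //.
  move=> on_z; apply/eqP.
  by rewrite !hornerE /= eq_norm_addsub conjC1 !mulr1 rmorphXn.
have circlesE z : lemniscate (RatFun nz2 cop2) z <-> on_circles n2 z.
  have E : (`|num2.[z]| == `|den2.[z]|) = on_circles n2 z.
    rewrite /num2 /den2 !hornerE /= eq_norm_addsub.
    rewrite !rmorphXn rmorphB rmorphD /= rmorph1.
    by rewrite -!exprMn.
  by rewrite lemniscateP /= -E; split=> [->|/eqP].
apply/seteqP; split=> z /=.
  by case=> /linesE lin /circlesE cir; rewrite mem_r lin cir.
by rewrite mem_r => /andP[lin cir]; split; [apply/linesE|apply/circlesE].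
Qed.

End ExtremalExample.

Theorem theorem1p1 (R : realType) :
  (forall (P1 P2 : ratfun R) (n1 n2 : nat),
     nonconstant P1 -> nonconstant P2 ->
     ratdeg P1 = n1 -> ratdeg P2 = n2 ->
     ((`I_(2 * n1 * n2).+1 #<= lemniscate P1 `&` lemniscate P2)%card <->
      infinite_set (lemniscate P1 `&` lemniscate P2)) /\
     (infinite_set (lemniscate P1 `&` lemniscate P2) <->
      exists W B1 B2 : ratfun R,
        [/\ P1 =1 B1 \o W, P2 =1 B2 \o W,
            preserves_circle B1 & preserves_circle B2])) /\
  (forall n1 n2 : nat, (1 <= n1)%N -> (1 <= n2)%N ->
     exists P1 P2 : ratfun R,
       [/\ ratdeg P1 = n1, ratdeg P2 = n2 &
           (lemniscate P1 `&` lemniscate P2 #= `I_(2 * n1 * n2))%card]).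
Proof.
split; last exact: extremal_lemniscates.
by move=> P1 P2 n1 n2 nc1 nc2 <- <-; apply: lemniscates_equivalence.
Qed.
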